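(* Let $(S_0,S_1,\dots)$ be a supermartingale relative to a nondecreasing sequence of $\sigma$-algebras $(H_{\le 0},H_{\le 1},\dots)$, with $S_0\le 0$ almost surely, and let $X_i:=S_i-S_{i-1}$, $i=1,2,\dots$. Suppose that for every $i=1,2,\dots$ there exist $H_{\le(i-1)}$-measurable random variables $C_{i-1}$ and $D_{i-1}$ and a positive real number $s_i$ such that, with probability 1, $$C_{i-1}\le X_i\le D_{i-1}\quad\text{and}\quad D_{i-1}-C_{i-1}\le 2s_i .$$ Then for all $f\in\mathcal{F}_+^{(5)}$ and all $n=1,2,\dots$ $$\mathsf{E} f(S_n)\le \mathsf{E} f(sZ),$$ where $s:=\sqrt{s_1^2+\dots+s_n^2}$ and $Z\sim N(0,1)$.
   Context: For $\alpha\ge 0$, $\mathcal{F}_+^{(\alpha)}$ denotes the class of all functions $f\colon\mathbb{R}\to\mathbb{R}$ of the form $f(x)=\int_{-\infty}^\infty (x-t)_+^\alpha\,\mu(dt)$ for all $x\in\mathbb{R}$ (the integral being finite for every $x$), where $\mu\ge 0$ is a Borel measure on $\mathbb{R}$, $x_+:=\max(0,x)$, $x_+^\alpha:=(x_+)^\alpha$, and $0^0:=0$. Such $f$ are nonnegative, so $\mathsf{E}f(\cdot)\in[0,\infty]$. *)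

(* Defs.v *)
From HB Require Import structures.
From mathcomp Require Import all_boot all_order all_algebra.
From mathcomp Require Import all_classical all_reals all_analysis.
Set Implicit Arguments.
Unset Strict Implicit.
Unset Printing Implicit Defensive.
Import Order.TTheory GRing.Theory Num.Theory.
Import numFieldNormedType.Exports.
Local Open Scope classical_set_scope.
Local Open Scope ring_scope.

Definition pospart (R : realType) (x : R) : R := Num.max 0 x.

(* The convention is 0^0 = 0, whereas the library has 0 `^ 0 = 1. *)
Definition pospow (R : realType) (a x : R) : R :=
  if pospart x == 0 then 0 else pospart x `^ a.

(* f is real-valued, so the equality in \bar R includes the finiteness of the
   integral for every x; mu itself need not be finite or sigma-finite. *)
Definition Fplus (R : realType) (a : R) : set (R -> R) :=
  [set f | exists mu : {measure set (measurableTypeR R) -> \bar R},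
    forall x : R, (f x)%:E = (\int[mu]_t (pospow a (x - t))%:E)%E].

Definition is_filtration (d : measure_display) (T : measurableType d)
    (H : nat -> set (set T)) : Prop :=
  [/\ forall n, sigma_algebra [set: T] (H n),
      forall n, H n `<=` measurable
    & forall m n, (m <= n)%N -> H m `<=` H n].

(* The measurable sets of g_sigma_algebraType G are those of <<s G >>, which is
   G itself when G is a sigma-algebra. *)
Definition sub_measurable (T : pointedType) (R : realType)
    (G : set (set T)) (f : T -> R) : Prop :=
  measurable_fun [set: g_sigma_algebraType G] (f : g_sigma_algebraType G -> R).

(* Y is a version of the conditional expectation of X given G. *)
Definition is_cond_expectation (d : measure_display) (T : measurableType d)
    (R : realType) (P : probability T R) (G : set (set T)) (X Y : T -> R) :
    Prop :=
  [/\ sub_measurable G Y,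
      P.-integrable [set: T] (EFin \o Y)
    & forall A, G A ->
        (\int[P]_(w in A) (Y w)%:E = \int[P]_(w in A) (X w)%:E)%E].

Definition supermartingale (d : measure_display) (T : measurableType d)
    (R : realType) (P : probability T R) (H : nat -> set (set T))
    (S : nat -> T -> R) : Prop :=
  [/\ forall n, sub_measurable (H n) (S n),
      forall n, P.-integrable [set: T] (EFin \o S n)
    & forall n, exists2 Y : T -> R, is_cond_expectation P (H n) (S n.+1) Y
        & {ae P, forall w, Y w <= S n w}].

Definition standard_normal (d : measure_display) (T : measurableType d)
    (R : realType) (P : probability T R) (Z : {RV P >-> R}) : Prop :=
  forall A : set R, measurable A -> distribution P Z A = normal_prob 0 1 A.

(* Main.v *)
(* By Tonelli it suffices to treat f(x) = (x - t)_+^5. Given the past, the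
   increment X lies in an interval [c, c + 2 s] and has nonpositive mean, so by
   convexity the chord over this interval reduces the one-step bound
   E (x + X)_+^5 <= E (x + s Z)_+^5 to centred two-point variables; the
   supermartingale property removes the term (slope of the chord) * X.
   Iterating, independent Gaussian steps add up in variance.
   For s = 1 and a two-point X with atoms 2 (1 - p) and - 2 p there are two
   regimes. If only the upper atom exceeds t, then E (X - t)_+^5 is
   p (2 - 2 p - t)^5, and its maximum over p is below an explicit lower bound
   on E (Z - t)_+^5 obtained from E Z_+^4 and E Z_+^5 by tangents. If both
   atoms exceed t, then E (X - t)_+^5 is a polynomial, compared with
   E (Z - t)^5. *)
Require Import Defs.
From HB Require Import structures.
From mathcomp Require Import all_boot all_order all_algebra.
From mathcomp Require Import all_classical all_reals all_analysis.
From mathcomp Require Import measurable_realfun ring lra.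
Set Implicit Arguments.
Unset Strict Implicit.
Unset Printing Implicit Defensive.
Import Order.TTheory GRing.Theory Num.Theory.
Import numFieldNormedType.Exports.
Local Open Scope classical_set_scope.
Local Open Scope ring_scope.

(** * Polynomial inequalities for fifth moments of two-point laws *)

Section fifth_powers.
Variable R : realFieldType.
Implicit Types a d p t u : R.

(* [E (Z + a)^5 - E (X + a)^5] for [Z] standard normal and [X] centred with
   values [2 (1 - p)], [- 2 p] of probabilities [p], [1 - p], where
   [d = 1 - 2 p]; written so that the square isolates the critical scale
   [a d = 1 - d^2]. *)
Definition fifth_moment_gap a d : R :=
  10 * a * (a * d - (1 - d ^+ 2)) ^+ 2 + 5 * a * d ^+ 2 * (2 + d ^+ 2)
  - 4 * d * (1 - d ^+ 4).

(** Nonnegativity of the gap at [a = 1 - d], divided by [1 - d], once the square is bounded below by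
    [(13/25 (1 - d^2))^2]; note [338/125 = 10 (13/25)^2]. *)
Lemma gap_ineq_small d : 0 <= d <= 3/5 ->
  4 * d * (1 + d) * (1 + d ^+ 2) <=
  338/125 * (1 - d ^+ 2) ^+ 2 + 5 * d ^+ 2 * (2 + d ^+ 2).
Proof.
move=> /andP[d0 d6].
have d4 : 0 <= d ^+ 4 by rewrite exprn_ge0.
(* This factor of the cubic and quartic terms increases up to [d = 3/5], where it is just under
   [13/20]. *)
have h3 : d ^+ 2 * (4 - 37/10 * d) <= 13/20.
  have : 0 <= (3/5 - d) * (267/250 + 89/50 * d - 37/10 * d ^+ 2).
    by apply: mulr_ge0; nra.
  lra.
have h4 : d * (d ^+ 2 * (4 - 37/10 * d)) <= d * (13/20) by apply: ler_wpM2l.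
have : 0 <= 338/125 - 4 * d + 74/125 * d ^+ 2 - d * (13/20) by nra.
lra.
Qed.

(** The same reduction at [a = 2/5]. An odd factor [d] is replaced by its AM-GM bound at the
    midpoint [13/20], which leaves a polynomial in [e = d^2]. *)
Lemma gap_ineq_mid d : 3/5 <= d <= 7/10 ->
  4 * d * (1 - d ^+ 4) <=
  2/5 * (338/125 * (1 - d ^+ 2) ^+ 2 + 5 * d ^+ 2 * (2 + d ^+ 2)).
Proof.
move=> /andP[d6 d7].
have el : 36/100 <= d ^+ 2 by nra.
have eu : d ^+ 2 <= 49/100 by nra.
have du : d <= (d ^+ 2 + 169/400) * (10/13).
  by have := sqr_ge0 (d - 13/20); lra.
have e4 : 0 <= 1 - d ^+ 4.
  by rewrite (_ : d ^+ 4 = d ^+ 2 * d ^+ 2); [nra|ring].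
have : d * (1 - d ^+ 4) <= (d ^+ 2 + 169/400) * (10/13) * (1 - d ^+ 4).
  by apply: ler_wpM2r.
have -> : d ^+ 4 = d ^+ 2 * d ^+ 2 by ring.
move: (d ^+ 2) el eu => e el eu.
have h1 : 0 <= (e - 36/100) * (49/100 - e) by apply: mulr_ge0; lra.
have h2 : 0 <= (e - 36/100) * e ^+ 2.
  by apply: mulr_ge0; [lra|exact: sqr_ge0].
nra.
Qed.

(** For large [d] or large [a d] the square is dropped. Otherwise it is at least [(13/25 w)^2], and
    the resulting bound increases with [a], so the least admissible [a] suffices: [1 - d] if
    [d <= 3/5], and [2/5] beyond. *)
Lemma fifth_moment_gap_ge0 a d : 2/5 <= a -> 1 - d <= a -> 0 <= d <= 1 ->
  0 <= fifth_moment_gap a d.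
Proof.
move=> a25 ad /andP[d0 d1]; rewrite /fifth_moment_gap.
have a0 : 0 <= a by lra.
have d2 : 0 <= d ^+ 2 by apply: sqr_ge0.
have d21 : d ^+ 2 <= 1 by rewrite expr_le1.
pose w := 1 - d ^+ 2; rewrite -/w.
have w0 : 0 <= w by rewrite /w subr_ge0.
have sq0 : 0 <= 10 * a * (a * d - w) ^+ 2 by rewrite mulr_ge0 ?sqr_ge0//; lra.
have E4 : 1 - d ^+ 4 = w * (1 + d ^+ 2) by rewrite /w; ring.
have [d7|d7] := leP (7/10) d.
  suff : 0 <= 5 * a * d ^+ 2 * (2 + d ^+ 2) - 4 * d * (1 - d ^+ 4) by lra.
  have -> : 5 * a * d ^+ 2 * (2 + d ^+ 2) - 4 * d * (1 - d ^+ 4) =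
    d * ((5 * a - 2) * (d * (2 + d ^+ 2)) + 2 * (d * (2 + d ^+ 2) - 2 * (1 - d ^+ 4))).
    ring.
  apply: mulr_ge0 => //; apply: addr_ge0.
    by apply: mulr_ge0; [lra|apply: mulr_ge0; lra].
  have : 49/100 <= d ^+ 2 by nra.
  move=> h; have : 0 <= d * (2 + d ^+ 2) - 7/10 * (2 + 49/100) by nra.
  have -> : d ^+ 4 = d ^+ 2 * d ^+ 2 by ring.
  by move=> ?; nra.
(* At the threshold [12/25] the remainder is [4/5 w (1 - 2 d^2)], nonnegative because [d < 7/10]. *)
have [adw|adw] := leP (12/25 * w) (a * d).
  suff : 0 <= 5 * a * d ^+ 2 * (2 + d ^+ 2) - 4 * d * (1 - d ^+ 4) by lra.
  have -> : 5 * a * d ^+ 2 * (2 + d ^+ 2) - 4 * d * (1 - d ^+ 4) =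
    d * (5 * (2 + d ^+ 2) * (a * d - 12/25 * w) + 4/5 * w * (1 - 2 * d ^+ 2)).
    by rewrite E4 /w; field.
  have : d ^+ 2 <= 1/2 by nra.
  move=> h.
  apply: mulr_ge0 => //; apply: addr_ge0; apply: mulr_ge0; nra.
have sq1 : 169/625 * w ^+ 2 <= (a * d - w) ^+ 2.
  have -> : (a * d - w) ^+ 2 = (w - a * d) ^+ 2 by ring.
  have -> : 169/625 * w ^+ 2 = (13/25 * w) ^+ 2 by field.
  by rewrite ler_sqr ?nnegrE; lra.
have sq2 : 10 * a * (169/625 * w ^+ 2) <= 10 * a * (a * d - w) ^+ 2.
  by apply: ler_wpM2l => //; lra.
set U := 338/125 * w ^+ 2 + 5 * d ^+ 2 * (2 + d ^+ 2).
have U0 : 0 <= U.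
  have w2 := sqr_ge0 w; have d4 := mulr_ge0 d2 d2.
  by rewrite /U; lra.
suff h : 4 * d * (1 - d ^+ 4) <= a * U.
  have E : a * U = 10 * a * (169/625 * w ^+ 2) + 5 * a * d ^+ 2 * (2 + d ^+ 2).
    by rewrite /U; field.
  by move: h; rewrite {}E => h; lra.
have [d6|d6] := leP d (3/5).
  apply: (@le_trans _ _ ((1 - d) * U)); last exact: ler_wpM2r.
  have -> : 4 * d * (1 - d ^+ 4) = (1 - d) * (4 * d * (1 + d) * (1 + d ^+ 2)) by ring.
  apply: ler_wpM2l; first by rewrite subr_ge0.
  by apply: gap_ineq_small; rewrite d0.
apply: (@le_trans _ _ (2/5 * U)); last exact: ler_wpM2r.
by apply: gap_ineq_mid; rewrite !ltW.
Qed.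

(** Meant for [a < 2/5], where the gap can be negative; a loss of at most 1 is made up later by the
    tangent bound with [l = 4/5]. *)
Lemma fifth_moment_gap_geN1 a d : 0 <= a -> 1 - d <= a -> 0 <= d <= 1 ->
  -1 <= fifth_moment_gap a d.
Proof.
move=> a0 ad /andP[d0 d1]; rewrite /fifth_moment_gap.
have sq0 : 0 <= 10 * a * (a * d - (1 - d ^+ 2)) ^+ 2.
  by rewrite mulr_ge0 ?sqr_ge0//; lra.
have h1 : (1 - d) * (5 * d ^+ 2 * (2 + d ^+ 2)) <= a * (5 * d ^+ 2 * (2 + d ^+ 2)).
  by apply: ler_wpM2r => //; apply: mulr_ge0; have := sqr_ge0 d; lra.
have d3 : 0 <= d ^+ 3 by rewrite exprn_ge0.
have h2 : 0 <= (1 - d) * d * (6 * d - 4 * d ^+ 2 + d ^+ 3).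
  by apply: mulr_ge0; [nra|have : d ^+ 2 <= d by nra]; lra.
have h3 : 0 <= (1 - 2 * d) ^+ 2 by rewrite sqr_ge0.
have E : (1 - d) * (5 * d ^+ 2 * (2 + d ^+ 2)) - 4 * d * (1 - d ^+ 4) + 1 =
  (1 - d) * d * (6 * d - 4 * d ^+ 2 + d ^+ 3) + (1 - 2 * d) ^+ 2 by ring.
lra.
Qed.

(* AM-GM for [10 p] and five copies of [u - 2 p], whose mean is [5 u / 6]. *)
Lemma mul_exp5_le p u : 0 <= p -> 2 * p <= u ->
  p * (u - 2 * p) ^+ 5 <= 3125/1458 * (u / 2) ^+ 6.
Proof.
move=> p0 pu; pose m := 5/6 * u; pose y := u - 2 * p.
have m0 : 0 <= m by rewrite /m; lra.
have y0 : 0 <= y by rewrite /y subr_ge0.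
(* The right side is [m^6 / 10] and [p = (6 m - 5 y) / 10], so the claim is
   [m^6 - 6 m y^5 + 5 y^6 >= 0], with double root [y = m]. *)
rewrite -subr_ge0 (_ : _ - _ = (m - y) ^+ 2 *
  (m ^+ 4 + 2 * m ^+ 3 * y + 3 * m ^+ 2 * y ^+ 2 + 4 * m * y ^+ 3 + 5 * y ^+ 4) / 10).
  rewrite divr_ge0// mulr_ge0 ?sqr_ge0//.
  have ge0 k l : 0 <= m ^+ k * y ^+ l by rewrite mulr_ge0 ?exprn_ge0.
  have := (ge0 4 0, ge0 3 1, ge0 2 2, ge0 1 3, ge0 0 4)%N.
  rewrite !expr0 !expr1 !mul1r !mulr1.
  by move=> [[[[h1 h2] h3] h4] h5]; lra.
by rewrite /m /y; field.
Qed.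

(** With [l = 1 - t / 2], this compares the AM-GM bound with the tangent bound after cancelling
    [l^4]. As [5 - 4 l = 1 + 2 t > 0], [A] may be replaced by [79/25], and a quadratic in [t]
    remains. *)
Lemma quadratic_tangent_bound (A t : R) : 79/25 <= A -> - (2/5) <= t <= 2 ->
  3125/1458 * (1 - t / 2) ^+ 2 <= (5 - 4 * (1 - t / 2)) * A - 15/2 * t.
Proof.
move=> A0 /andP[t25 t2].
have : 0 <= (1 + 2 * t) * (A - 79/25) by apply: mulr_ge0; lra.
nra.
Qed.

(* Here [g] stands for [E (Z - t)_+^5] and [A] for [E Z_+^5]; the two families
   of hypotheses are what integrating the tangent bound
   [y^5 >= 5 x^4 y - 4 x^5] at [x = l Z_+] gives, directly and after
   [u_+^5 = u^5 + (- u)_+^5]. *)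
Lemma two_point_fifth_moment_le (A p t g : R) : 79/25 <= A -> 0 <= p <= 1 ->
  (forall l, 0 <= l <= 5/4 ->
     l ^+ 4 * ((5 - 4 * l) * A - 15/2 * t) <= g) ->
  (forall l, 0 <= l <= 5/4 ->
     (- t) ^+ 5 + 10 * (- t) ^+ 3 + 15 * (- t)
       + l ^+ 4 * ((5 - 4 * l) * A + 15/2 * t) <= g) ->
  p * Num.max 0 (2 * (1 - p) - t) ^+ 5 + (1 - p) * Num.max 0 (- (2 * p) - t) ^+ 5
    <= g.
Proof.
move=> A0 /andP[p0 p1] g1 g2.
have g0 : 0 <= g by have := g1 0; rewrite expr0n/= mul0r; apply; lra.
have max0l (x : R) : x <= 0 -> Num.max 0 x = 0 by move=> x0; apply/max_idPl.
(* First regime: both atoms are at least [t]. In the notation below, [a = - t >= 2 p = 1 - e]. *)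
have [tp|tp] := leP t (- (2 * p)).
  rewrite !(max_idPr _); [|lra|lra].
  have [a Ea] : {a | t = - a} by exists (- t); rewrite opprK.
  have [e Ee] : {e | p = (1 - e) / 2} by exists (1 - 2 * p); field.
  have E : p * (2 * (1 - p) - t) ^+ 5 + (1 - p) * (- (2 * p) - t) ^+ 5 =
    a ^+ 5 + 10 * a ^+ 3 + 15 * a - fifth_moment_gap a e.
    by rewrite /fifth_moment_gap Ea Ee; field.
  rewrite {}E.
  move: g2; rewrite Ea opprK => g2.
  have g20 : a ^+ 5 + 10 * a ^+ 3 + 15 * a <= g.
    by have := g2 0; rewrite expr0n/= mul0r addr0; apply; lra.
  (* For [e < 0], that is [p > 1/2], every term of the gap is nonnegative. *)
  have [e0|e0] := leP 0 e; last first.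
    suff : 0 <= fifth_moment_gap a e by lra.
    rewrite /fifth_moment_gap -addrA addr_ge0//.
      by rewrite mulr_ge0 ?sqr_ge0//; lra.
    have e2 : e ^+ 2 <= 1 by nra.
    have -> : e ^+ 4 = e ^+ 2 * e ^+ 2 by ring.
    have e20 := sqr_ge0 e.
    apply: addr_ge0; first by apply: mulr_ge0; [apply: mulr_ge0|]; lra.
    rewrite -mulNr mulr_ge0//; [lra|nra].
  have [a25|a25] := leP (2/5) a.
    have : 0 <= fifth_moment_gap a e by apply: fifth_moment_gap_ge0; lra.
    lra.
  have : -1 <= fifth_moment_gap a e by apply: fifth_moment_gap_geN1; lra.
  (* [l = 4/5] adds [256/625 (9/5 A - 15/2 a)], which exceeds 1 when [A >= 79/25] and [a < 2/5]. *)
  have := g2 (4/5); move=> h h1.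
  have {}h : a ^+ 5 + 10 * a ^+ 3 + 15 * a + 256/625 * (9/5 * A - 15/2 * a) <= g.
    have -> : 256/625 * (9/5 * A - 15/2 * a) =
       (4/5) ^+ 4 * ((5 - 4 * (4/5)) * A + 15/2 * (- a)) by field.
    by apply: h; lra.
  lra.
rewrite (max0l (- (2 * p) - t)); last by lra.
rewrite expr0n/= mulr0 addr0.
have [tq|tq] := leP (2 * (1 - p)) t.
  by rewrite max0l ?expr0n ?mulr0//=; lra.
rewrite (max_idPr _); last by lra.
have [t25|t25] := leP (- (2/5)) t.
  (* Only the upper atom counts here. AM-GM with [u = 2 - t] produces [(1 - t / 2)^6], which
     dictates the choice of [l]; [t >= - 2/5] keeps [l <= 6/5]. *)
  have := g1 (1 - t / 2) _; rewrite (_ : 0 <= _ <= _); last by lra.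
  move=> /(_ isT); apply: le_trans.
  rewrite (_ : 2 * (1 - p) - t = (2 - t) - 2 * p); last by ring.
  apply: le_trans (mul_exp5_le p0 _) _; first by lra.
  rewrite (_ : (2 - t) / 2 = 1 - t / 2); last by field.
  rewrite (exprD _ 4 2) mulrCA; apply: ler_wpM2l; first by rewrite exprn_even_ge0.
  by apply: quadratic_tangent_bound => //; lra.
have := g2 0; rewrite expr0n/= mul0r addr0 => /(_ _); rewrite lexx /= => g20.
apply: (@le_trans _ _ ((- t) ^+ 5 + 10 * (- t) ^+ 3 + 15 * (- t))); last first.
  by apply: g20; lra.
have [a Ea] : {a | t = - a} by exists (- t); rewrite opprK.
rewrite {}Ea in tp tq t25 *; rewrite !opprK.
pose y := 2 * (1 - p) + a.
have y0 : 0 <= y by rewrite /y; lra.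
have y2 : y <= 2 by rewrite /y; lra.
have Ep : p = (2 + a - y) / 2 by rewrite /y; field.
rewrite -/y Ep.
(* [16 a] is the value at [y = 2], where the lower atom reaches [t]; hence the factor [2 - y]. Since
   [10 a^2 >= 1], it is below [a^5 + 10 a^3 + 15 a]. *)
apply: (@le_trans _ _ (16 * a)).
  rewrite -subr_ge0 (_ : _ - _ = (2 - y) / 2 *
    (a * (16 + 8 * y + 4 * y ^+ 2 + 2 * y ^+ 3 + y ^+ 4) - y ^+ 5)); last by field.
  apply: mulr_ge0; first by lra.
  have y4 : 0 <= y ^+ 4 by rewrite exprn_ge0.
  have y3 : y ^+ 4 <= 2 * y ^+ 3 by rewrite exprS ler_wpM2r ?exprn_ge0.
  have y22 : y ^+ 3 <= 2 * y ^+ 2 by rewrite exprS ler_wpM2r ?exprn_ge0.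
  have y21 : y ^+ 2 <= 2 * y by rewrite expr2 ler_wpM2r.
  have : 2/5 * (5 * y ^+ 4) <= a * (16 + 8 * y + 4 * y ^+ 2 + 2 * y ^+ 3 + y ^+ 4).
    by apply: ler_pM; lra.
  have : y ^+ 5 <= 2 * y ^+ 4 by rewrite exprS ler_wpM2r.
  lra.
have a5 : 0 <= a ^+ 5 by rewrite exprn_ge0//; lra.
have : a <= 10 * a ^+ 3.
  have -> : 10 * a ^+ 3 = a * (10 * a ^+ 2) by ring.
  rewrite -[leLHS]mulr1; apply: ler_wpM2l; [lra|nra].
lra.
Qed.
End fifth_powers.

(** * A numerical upper bound for pi *)

(** The first three terms of the cosine series already have a negative sum, and the later ones,
    grouped in consecutive pairs, contribute negative amounts. *)
Lemma cos85_lt0 (R : realType) : cos (8/5) < 0 :> R.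
Proof.
rewrite -(opprK (cos _)) oppr_lt0; have /cvgN h := @cvg_cos_coeff' R (8/5).
rewrite -(cvg_lim (@Rhausdorff R) h).
apply: (@lt_trans _ _ (\sum_(0 <= i < 3) - cos_coeff' (8/5) i)).
  rewrite 3?big_nat_recl// big_nil addr0 /cos_coeff' -!exprnP !factS fact0.
  by rewrite /=; lra.
rewrite -seriesN lt_sum_lim_series //.
  by move/cvgP in h; by rewrite seriesN.
(* A pair starts at an odd index [m], and its second term is smaller by the ratio
   [(64/25) / ((u + 2) (u + 1))], where [u = 2 m]. *)
move=> n; rewrite addnS; set m := (3 + n.*2)%N; rewrite /cos_coeff' -!exprnP.
have sm : (-1 : R) ^+ m = -1.
  by rewrite -signr_odd /m oddD /= odd_double.
rewrite (exprS (-1 : R) m) sm; have m0 : (0 < m)%N by [].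
move: m {sm} m0 => m m0.
rewrite mulrNN mulr1 mul1r mulN1r mulNr opprK doubleS !exprSr !factS !natrM.
set F : R := (m.*2)`!%:R; set X : R := (8/5) ^+ m.*2.
have F0 : 0 < F by rewrite /F ltr0n fact_gt0.
have X0 : 0 < X by rewrite exprn_gt0//; lra.
pose u : R := (m.*2)%:R.
have u1 : 1 <= u by rewrite /u ler1n double_gt0.
have -> : (m.*2.+1)%:R = u + 1 :> R by rewrite -natr1.
have -> : (m.*2.+2)%:R = u + 2 :> R by rewrite -addn2 natrD.
have -> : X / F - X * (8/5) * (8/5) / ((u + 2) * ((u + 1) * F)) =
   X / F * (1 - (64/25) / ((u + 2) * (u + 1))).
   by field; rewrite !gt_eqF//; lra.
rewrite mulr_gt0 ?divr_gt0// subr_gt0.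
by rewrite ltr_pdivrMr ?mul1r; nra.
Qed.

Lemma pi_lt (R : realType) : pi < 16/5 :> R.
Proof.
rewrite ltNge; apply/negP => h; have := cos85_lt0 R.
apply/negP; rewrite -leNgt; apply: cos_ge0_pihalf.
by apply/andP; split; have := pi_ge0 R; lra.
Qed.

(** * The standard normal density *)

Section normal_density_facts.
Variable R : realType.
Local Notation mu := (@lebesgue_measure R).
Local Notation phi := (normal_pdf (0:R) 1).

Lemma ge0_integral_affine (G : R -> R) (a b : R) : 0 < a -> continuous G ->
  (forall x, 0 <= G x) ->
  (\int[mu]_x (G x)%:E = \int[mu]_x (G (a * x + b) * a)%:E)%E.
Proof.
move=> a0 cG G0.
have dF (x : R) : is_derive x 1 (fun x => a * x + b) a.
  by apply: is_derive_eq; rewrite addr0 [_%:A]mulr1.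
have F'E : derive1 (fun x : R => a * x + b) = cst a.
  by apply/funext => x; rewrite derive1E derive_val.
rewrite (@increasing_ge0_integration_by_substitutionT _ (fun x => a * x + b) G)//.
- by apply: eq_integral => x _; rewrite /= F'E.
- by move=> x y xy; rewrite ltrD2r ltr_pM2l.
- by rewrite F'E => ?; exact: cvg_cst.
- by rewrite F'E; exact: is_cvg_cst.
- by rewrite F'E; exact: is_cvg_cst.
- apply: (@cvg_comp _ _ _ ( *%R a) (+%R^~ b)); last exact: cvg_addrr_Ny.
  by apply: gt0_cvgMrNy => //; exact: cvg_id.
- apply: (@cvg_comp _ _ _ ( *%R a) (+%R^~ b)); last exact: cvg_addrr.
  by apply: gt0_cvgMry => //; exact: cvg_id.
Qed.

Lemma normal_pdf01E x : phi x = phi 0 * expR (- x ^+ 2 / 2).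
Proof.
rewrite normal_pdfE// /normal_fun !subr0 expr1n expr0n/= oppr0 mul0r expR0 mulr1.
by [].
Qed.

Lemma normal_pdf01_gt0 x : 0 < phi x.
Proof. by rewrite normal_pdfE//= mulr_gt0 ?expR_gt0// normal_peak_gt0. Qed.

Lemma normal_pdf01N x : phi (- x) = phi x.
Proof. by rewrite normal_pdf01E sqrrN -normal_pdf01E. Qed.

(** Source of the constant [79/25], since [E Z_+^5 = 8 phi 0]. It holds because
    [2 pi < 32/5 < (200/79)^2]. *)
Lemma normal_pdf01_0_ge : 79/200 <= phi 0.
Proof.
rewrite normal_pdfE//= /normal_fun subr0 expr0n/= oppr0 mul0r expR0 mulr1.
rewrite /normal_peak expr1n mul1r.
have s0 : 0 < Num.sqrt (pi *+ 2 : R) by rewrite sqrtr_gt0 pmulrn_lgt0 ?pi_gt0.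
have h : Num.sqrt (pi *+ 2 : R) <= 200/79.
  rewrite -[leRHS]ger0_norm; last by lra.
  rewrite -sqrtr_sqr ler_sqrt; last by apply: sqr_ge0.
  by have := pi_lt R; rewrite mulr2n => ?; rewrite expr2; lra.
have -> : 79/200 = (200/79)^-1 :> R by rewrite invfM invrK mulrC.
by rewrite lef_pV2 ?posrE//; lra.
Qed.


Lemma is_derive_normal_pdf01 (x : R) : is_derive x 1 phi (- x * phi x).
Proof.
have -> : phi = (fun y => phi 0 * expR (- y ^+ 2 / 2)).
  by apply/funext => y; rewrite -normal_pdf01E.
apply: is_derive_eq.
rewrite /GRing.scale/=.
by field.
Qed.

(** The term of order [k + 1] in the exponential series of [x^2 / 2] gives the bound [C / x] for
    [x >= 1]. *)
Lemma cvg_exprM_normal_pdf01 k : x ^+ k * phi x @[x --> +oo] --> (0 : R).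
Proof.
pose C : R := phi 0 * (k.+1`!%:R * 2 ^+ k.+1).
apply: (@squeeze_cvgr _ _ _ _ (cst 0) (fun x => C * x^-1)).
- near=> x.
  have x1 : 1 <= x by near: x; exact: nbhs_pinfty_ge.
  have x0 : 0 < x by apply: lt_le_trans x1.
  have xk0 j : 0 < x ^+ j by rewrite exprn_gt0.
  rewrite mulr_ge0 ?(ltW (xk0 _)) ?normal_pdf_ge0//=.
rewrite normal_pdf01E mulNr expRN /C mulrCA -[leRHS]mulrA.
  rewrite ler_pM2l ?normal_pdf01_gt0//.
  have f0 : 0 < k.+1`!%:R :> R by rewrite ltr0n fact_gt0.
  have h : (x ^+ 2 / 2) ^+ k.+1 / k.+1`!%:R <= expR (x ^+ 2 / 2).
    apply: le_trans (expR_ge1Dxn k _); first by rewrite lerDr.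
    by rewrite divr_ge0 ?sqr_ge0.
  rewrite ler_pdivrMr ?expR_gt0//.
  apply: (@le_trans _ _ (k.+1`!%:R * 2 ^+ k.+1 / x *
    ((x ^+ 2 / 2) ^+ k.+1 / k.+1`!%:R))); last first.
    by rewrite ler_pM2l// divr_gt0// mulr_gt0// exprn_gt0.
  rewrite expr_div_n.
  have -> : k.+1`!%:R * 2 ^+ k.+1 / x * ((x ^+ 2) ^+ k.+1 / 2 ^+ k.+1 / k.+1`!%:R) =
     (x ^+ 2) ^+ k.+1 / x.
    by field; rewrite !gt_eqF// exprn_gt0.
  rewrite -exprM mul2n doubleS exprSr mulfK ?gt_eqF//.
  by rewrite ler_eXn2l// -addnn -addnS leq_addr.
- exact: cvg_cst.
- rewrite -[X in _ --> X](mulr0 C); apply: cvgM; first exact: cvg_cst.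
  apply/gtr0_cvgV0; last exact: cvg_id.
  by near=> x; near: x; exact: nbhs_pinfty_gt.
Unshelve. all: by end_near. Qed.
End normal_density_facts.

(** * Moments of the normal law on the half-line *)

Section half_line_moments.
Variable R : realType.
Local Notation mu := (@lebesgue_measure R).
Local Notation phi := (normal_pdf (0:R) 1).

(* The library's FTC on a half-line wants a nonnegative integrand; a
   finite-interval part absorbs the sign changes. *)
Lemma half_line_FTC (f F : R -> R) (c : R) : 0 < c -> continuous f ->
  (forall x : R, is_derive x 1 F (f x)) -> (forall x, c <= x -> 0 <= f x) ->
  F x @[x --> +oo] --> (0 : R) ->
  mu.-integrable `[0, +oo[ (EFin \o f) /\
  (\int[mu]_(x in `[0%R, +oo[) (f x)%:E = (- F 0)%:E)%E.
Proof.
move=> c0 cf dF f0 F0.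
have derF x : derivable F x 1 by have [] := dF x.
have cF : continuous F.
  by move=> x; apply/differentiable_continuous/derivable1_diffP.
have dFE x : derive1 F x = f x by rewrite derive1E derive_val.
have mf : measurable_fun setT f by exact: continuous_measurable_fun.
have UE : `[0, +oo[%classic = `[0, c[%classic `|` `[c, +oo[%classic :> set R.
  apply/seteqP; split => x /=; rewrite !in_itv/= !andbT.
    by move=> x0; case: (leP c x) => cx; [right|left; rewrite x0].
  by case=> [/andP[]//|cx]; rewrite (le_trans (ltW c0)).
have disj : [disjoint `[0, c[%classic & `[c, +oo[%classic : set R].
  apply/disj_setPS => x /= []; rewrite !in_itv/= andbT => /andP[_ +] cx.
  by rewrite ltNge cx.
have i1 : (\int[mu]_(x in `[0%R, c]) (f x)%:E = (F c)%:E - (F 0)%:E)%E.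
  apply: continuous_FTC2 => //.
  - exact: continuous_subspaceT.
  - split => [x _|//|//]; first exact: derF.
    exact: cvg_at_right_filter (cF 0).
  exact: cvg_at_left_filter (cF c).
have int1 : mu.-integrable `[0, c[ (EFin \o f).
  refine (@integrableS _ _ _ mu `[0, c]%classic _ _
    (measurable_itv _) (measurable_itv _) _ _).
    by apply: subset_itvl; rewrite bnd_simp.
  apply: continuous_compact_integrable; first exact: segment_compact.
  exact: continuous_subspaceT.
have i2 : (\int[mu]_(x in `[c, +oo[) (f x)%:E = 0%:E - (F c)%:E)%E.
  apply: ge0_continuous_FTC2y => //.
    exact: continuous_subspaceT.
  exact: cvg_at_right_filter (cF c).
have mfD (D : set R) : measurable_fun D (EFin \o f).
  by apply/measurable_EFinP; exact: measurable_funTS.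
split.
  apply/integrableP; split; first exact: mfD.
  rewrite UE ge0_integral_setU//=; last first.
    apply/measurable_EFinP; apply: measurableT_comp => //.
    exact: measurable_funTS.
  apply: lte_add_pinfty; first by have /integrableP[] := int1.
  under eq_integral.
    by move=> x; rewrite inE/= in_itv/= andbT => cx; rewrite ger0_norm ?f0//; over.
  by rewrite i2 ltry.
rewrite UE integral_setU//; last exact: mfD.
rewrite integral_itv_bndo_bndc//.
by rewrite i1 i2 -!EFinD; congr EFin; ring.
Qed.

(** This is [E Z_+^k] for [k >= 1], and [P(Z >= 0)] for [k = 0]. *)
Definition half_moment k := \int[mu]_(x in `[0, +oo[) (x ^+ k * phi x).

Lemma integral0y_normal_pdf01 : (\int[mu]_(x in `[0%R, +oo[) (phi x)%:E = (1/2)%:E)%E.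
Proof.
have := integral_normal_pdf (0 : R) 1.
rewrite ge0_symfun_integralT//; last 3 first.
- by move=> x; exact: normal_pdf_ge0.
- exact: continuous_normal_pdf.
- by move=> x; rewrite /= normal_pdf01N.
rewrite (_ : [set x | _] = `[0, +oo[%classic); last first.
  by apply/seteqP; split => x/=; rewrite in_itv/= andbT.
set I := integral _ _ _; move: I => [r| |].
- by rewrite -EFinM => -[] h; congr EFin; lra.
- by rewrite gt0_muley ?lte_fin.
- by rewrite gt0_muleNy ?lte_fin.
Qed.


Lemma half_moment_is_derive k (x : R) :
  is_derive x 1 (fun y => - (y ^+ k.+1 * phi y))
    (x ^+ k.+2 * phi x - k.+1%:R * (x ^+ k * phi x)).
Proof.
have h := is_derive_normal_pdf01 x.
have h1 : is_derive x 1 (fun y : R => y ^+ k.+1) (k.+1%:R * x ^+ k).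
  have -> : (fun y : R => y ^+ k.+1) = (@id R) ^+ k.+1.
    by apply/funext => y; rewrite exprfctE.
  by apply: is_derive_eq; rewrite /GRing.scale/= mulr1.
have h2 : is_derive x 1 (fun y => y ^+ k.+1 * phi y) _ := is_deriveM h1 h.
have h3 : is_derive x 1 (fun y => - (y ^+ k.+1 * phi y)) _ := is_deriveN h2.
apply: is_derive_eq.
rewrite /GRing.scale/= !exprS; ring.
Qed.



Lemma continuous_expM_pdf k : continuous (fun x : R => x ^+ k * phi x).
Proof.
move=> x; apply: cvgM; first exact: exprn_continuous.
exact: continuous_normal_pdf.
Qed.

Lemma half_moment1 : mu.-integrable `[0, +oo[ (fun x => (x ^+ 1 * phi x)%:E) /\
  half_moment 1 = phi 0.
Proof.
have [| | | | |i e] := @half_line_FTC (fun x => x ^+ 1 * phi x) (fun x => - phi x) 1.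
- by [].
- exact: continuous_expM_pdf.
- move=> x; have := is_derive_normal_pdf01 x => h.
  by apply: is_derive_eq; rewrite expr1 mulNr opprK.
- by move=> x x1; rewrite mulr_ge0 ?normal_pdf_ge0// expr1; lra.
- rewrite -[X in _ --> X]oppr0; apply: cvgN.
  have := @cvg_exprM_normal_pdf01 R 0.
  by under eq_fun do rewrite expr0 mul1r.
split => //.
by rewrite /half_moment /Rintegral e opprK.
Qed.

(** Integration by parts: the antiderivative [- x^(k+1) phi x] vanishes at 0 and at infinity. The
    integrand is nonnegative from [k + 1] on, where [x^2 >= x >= k + 1]. *)
Lemma half_momentSS k :
  mu.-integrable `[0, +oo[ (fun x => (x ^+ k * phi x)%:E) ->
  mu.-integrable `[0, +oo[ (fun x => (x ^+ k.+2 * phi x)%:E) /\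
  half_moment k.+2 = k.+1%:R * half_moment k.
Proof.
move=> ik.
have [| | | | |i e] := @half_line_FTC
    (fun x => x ^+ k.+2 * phi x - k.+1%:R * (x ^+ k * phi x))
    (fun x => - (x ^+ k.+1 * phi x)) k.+1%:R.
- by [].
- move=> x; apply: cvgB; first exact: continuous_expM_pdf.
  apply: cvgM; first exact: cvg_cst.
  exact: continuous_expM_pdf.
- exact: half_moment_is_derive.
- move=> x x1.
  have x11 : 1 <= x by apply: le_trans x1; rewrite ler1n.
  have -> : x ^+ k.+2 * phi x - k.+1%:R * (x ^+ k * phi x) =
    (x * x - k.+1%:R) * (x ^+ k * phi x) by rewrite !exprS; ring.
  rewrite mulr_ge0 ?subr_ge0//; last first.
    by rewrite mulr_ge0 ?exprn_ge0 ?normal_pdf_ge0//; lra.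
  by apply: (le_trans x1); rewrite ler_peMl//; lra.
- rewrite -[X in _ --> X]oppr0; apply: cvgN.
  exact: cvg_exprM_normal_pdf01.
have mI : measurable (`[0, +oo[%classic : set (measurableTypeR R)) by [].
have ik' : mu.-integrable `[0, +oo[ (EFin \o (fun x => k.+1%:R * (x ^+ k * phi x))).
  have := integrableZl mI k.+1%:R ik.
  by apply: eq_integrable => // x _; rewrite /= EFinM.
have E x : x ^+ k.+2 * phi x =
    (x ^+ k.+2 * phi x - k.+1%:R * (x ^+ k * phi x)) +
    k.+1%:R * (x ^+ k * phi x).
  by rewrite subrK.
split.
  have := integrableD mI i ik'.
  by apply: eq_integrable => // x _; rewrite [in RHS]E.
rewrite /half_moment.
under eq_Rintegral do rewrite E.
rewrite RintegralD// RintegralZl//.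
by rewrite {1}/Rintegral e/= expr0n/= mul0r !oppr0 add0r.
Qed.
End half_line_moments.

(** The Radon-Nikodym derivative and the explicit density have the same integral over every
    measurable set, hence agree almost everywhere. *)
Lemma integral_normal_prob (R : realType) (m s : R) (f : R -> \bar R) :
  measurable_fun [set: R] f -> (forall x, 0 <= f x)%E ->
  (\int[normal_prob m s]_x f x =
   \int[lebesgue_measure]_x (f x * (normal_pdf m s x)%:E))%E.
Proof.
move=> mf f0.
have dom := @normal_prob_dominates R m s.
rewrite -(Radon_Nikodym_SigmaFinite.change_of_variables dom)//.
pose g := Radon_Nikodym_SigmaFinite.f (normal_prob m s) (@lebesgue_measure R).
have mg : measurable_fun setT g.
  exact: measurable_int (Radon_Nikodym_SigmaFinite.f_integrable dom).
have mpdf : measurable_fun setT (fun x => (normal_pdf m s x)%:E).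
  by apply/measurable_EFinP; exact: measurable_normal_pdf.
apply: ae_eq_integral => //.
- exact: emeasurable_funM.
- exact: emeasurable_funM.
have gE : ae_eq lebesgue_measure setT g (fun x => (normal_pdf m s x)%:E).
  apply: integral_ae_eq => //.
  - exact: Radon_Nikodym_SigmaFinite.f_integrable.
  - by move=> E _ mE; rewrite -Radon_Nikodym_SigmaFinite.f_integral.
by apply: filterS gE => x + Dx => /(_ Dx); rewrite /g /= => ->.
Qed.

(** * Gaussian against centred two-point laws at unit scale *)

Section two_point_comparison.
Variable R : realType.
Local Notation mu := (@lebesgue_measure R).
Local Notation phi := (normal_pdf (0:R) 1).
Local Notation gauss := (normal_prob (0:R) 1).

Lemma integral_gauss_half_line (g : R -> R) : measurable_fun [set: R] g ->
  (forall x, 0 <= g x) ->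
  (\int[gauss]_x (g x)%:E =
   \int[mu]_(x in `[0%R, +oo[) ((g x + g (- x)) * phi x)%:E)%E.
Proof.
move=> mg g0.
have mp : measurable_fun [set: R] phi by exact: measurable_normal_pdf.
have mgN : measurable_fun [set: R] (fun x => g (- x)) by exact: measurableT_comp.
have p0 x : 0 <= phi x by exact: normal_pdf_ge0.
rewrite integral_normal_prob//; last exact/measurable_EFinP.
under eq_integral do rewrite -EFinM.
have mgp (D : set R) : measurable_fun D (EFin \o (fun x => g x * phi x)).
  by apply/measurable_EFinP; apply: measurable_funTS; exact: measurable_funM.
have mgNp (D : set R) : measurable_fun D (EFin \o (fun x => g (- x) * phi x)).
  by apply/measurable_EFinP; apply: measurable_funTS; exact: measurable_funM.
have UT : [set: R] = `]-oo, 0%R]%classic `|` `]0%R, +oo[%classic.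
  by rewrite -setCitvl setUv.
rewrite UT ge0_integral_setU//=; last 3 first.
- exact: mgp.
- by move=> x _; rewrite lee_fin mulr_ge0.
- apply/disj_setPS => x /= []; rewrite !in_itv/= andbT => x0.
  by rewrite ltNge x0.
rewrite integral_itv_obnd_cbnd; last exact: mgp.
under [in RHS]eq_integral do rewrite mulrDl EFinD.
rewrite ge0_integralD//=; last 4 first.
- by move=> x _; rewrite lee_fin mulr_ge0.
- exact: mgp.
- by move=> x _; rewrite lee_fin mulr_ge0.
- exact: mgNp.
rewrite addeC; congr (_ + _)%E.
rewrite ge0_integration_by_substitution0//.
- by apply: eq_integral => x _; rewrite opprK normal_pdf01N.
- by move=> x; rewrite lee_fin mulr_ge0.
Qed.

Lemma half_moments :
  [/\ forall k, mu.-integrable `[0, +oo[ (fun x => (x ^+ k * phi x)%:E),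
     half_moment R 0 = 1/2, half_moment R 2 = 1/2, half_moment R 4 = 3/2 &
     half_moment R 5 = 8 * phi 0].
Proof.
have i0 : mu.-integrable `[0, +oo[ (fun x => (x ^+ 0 * phi x)%:E).
  have mI : measurable (`[0, +oo[%classic : set (measurableTypeR R)) by [].
  have h := integrableS measurableT mI (@subsetT _ _) (integrable_normal_pdf (0 : R) 1).
  by apply: eq_integrable h => // x _; rewrite expr0 mul1r.
have [i1 e1] := half_moment1 R.
have H k : mu.-integrable `[0, +oo[ (fun x => (x ^+ k * phi x)%:E) /\
           mu.-integrable `[0, +oo[ (fun x => (x ^+ k.+1 * phi x)%:E).
  elim: k => [|k [ik ik1]]; first by [].
  by split => //; exact: (half_momentSS ik).1.
have m0 : half_moment R 0 = 1/2.
  rewrite /half_moment; under eq_Rintegral do rewrite expr0 mul1r.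
  by rewrite /Rintegral integral0y_normal_pdf01.
have e2 := (half_momentSS (H 0).1).2.
have e4 := (half_momentSS (H 2).1).2.
have e3 := (half_momentSS (H 1).1).2.
have e5 := (half_momentSS (H 3).1).2.
split => //.
- by move=> k; exact: (H k).1.
- by rewrite e2 m0; lra.
- by rewrite e4 e2 m0; lra.
- by rewrite e5 e3 e1; lra.
Qed.

(** Folding the line at 0 reduces a lower bound on [E g(Z)] to a polynomial bound on
    [g x + g (- x)]; the weights are the half-line moments of orders 0, 2, 4, 5. *)
Lemma integral_gauss_ge (g : R -> R) (c0 c2 c4 c5 : R) :
  measurable_fun [set: R] g -> (forall x, 0 <= g x) ->
  (forall x, 0 <= x ->
    c0 + c2 * x ^+ 2 + c4 * x ^+ 4 + c5 * x ^+ 5 <= g x + g (- x)) ->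
  ((1/2 * c0 + 1/2 * c2 + 3/2 * c4 + 8 * phi 0 * c5)%:E <= \int[gauss]_x (g x)%:E)%E.
Proof.
move=> mg g0 h; rewrite integral_gauss_half_line//.
have mp : measurable_fun [set: R] phi by exact: measurable_normal_pdf.
have p0 x : 0 <= phi x by exact: normal_pdf_ge0.
have mgN : measurable_fun [set: R] (fun x => g (- x)) by exact: measurableT_comp.
set J := integral _ _ _.
(* Once [J] is finite, both sides are integrable and real integrals can be compared. *)
have [->|Joo] := eqVneq J +oo%E; first by rewrite leey.
have [int e0 e2 e4 e5] := half_moments.
have mI : measurable (`[0, +oo[%classic : set (measurableTypeR R)) by [].
have intc c k : mu.-integrable `[0, +oo[ (EFin \o (fun x => c * (x ^+ k * phi x))).
  have := integrableZl mI c (int k).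
  by apply: eq_integrable => // x _; rewrite /= EFinM.
pose q x := c0 * (x ^+ 0 * phi x) + c2 * (x ^+ 2 * phi x) + c4 * (x ^+ 4 * phi x)
   + c5 * (x ^+ 5 * phi x).
have i2 : mu.-integrable `[0, +oo[
    (EFin \o (fun x => c0 * (x ^+ 0 * phi x) + c2 * (x ^+ 2 * phi x))).
  have := integrableD mI (intc c0 0) (intc c2 2).
  by apply: eq_integrable => // x _; rewrite /= EFinD.
have i4 : mu.-integrable `[0, +oo[
    (EFin \o (fun x => c0 * (x ^+ 0 * phi x) + c2 * (x ^+ 2 * phi x) +
      c4 * (x ^+ 4 * phi x))).
  have := integrableD mI i2 (intc c4 4).
  by apply: eq_integrable => // x _; rewrite /= EFinD.
have iq : mu.-integrable `[0, +oo[ (EFin \o q).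
  have := integrableD mI i4 (intc c5 5).
  by apply: eq_integrable => // x _; rewrite /= EFinD.
have iJ : mu.-integrable `[0, +oo[ (EFin \o (fun x => (g x + g (- x)) * phi x)).
  apply/integrableP; split.
    apply/measurable_EFinP; apply: measurable_funTS; apply: measurable_funM => //.
    exact: measurable_funD.
  under eq_integral do rewrite /= ger0_norm ?mulr_ge0 ?addr_ge0//.
  by rewrite ltey.
rewrite /J -(fineK (integrable_fin_num mI iJ)) lee_fin.
have <- : \int[mu]_(x in `[0, +oo[) q x = 1/2 * c0 + 1/2 * c2 + 3/2 * c4 + 8 * phi 0 * c5.
  have ec c k : \int[mu]_(x in `[0, +oo[) (c * (x ^+ k * phi x)) = c * half_moment R k.
    by rewrite RintegralZl//; exact: int.
  by rewrite /q !RintegralD// !ec e0 e2 e4 e5; ring.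
apply: le_Rintegral => //.
move=> x; rewrite /= in_itv/= andbT => x0.
rewrite (_ : q x = (c0 + c2 * x ^+ 2 + c4 * x ^+ 4 + c5 * x ^+ 5) * phi x).
  by apply: ler_wpM2r => //; exact: h.
by rewrite /q; ring.
Qed.

Definition pos5 (x : R) : R := Num.max 0 x ^+ 5.

Lemma pos5_ge0 x : 0 <= pos5 x.
Proof. by rewrite exprn_ge0// le_max lexx. Qed.

Lemma continuous_pos5 : continuous pos5.
Proof.
move=> x; rewrite /pos5.
apply: (@continuous_comp _ _ _ (fun y : R => Num.max 0 y) (fun y : R => y ^+ 5)).
  by apply: continuous_max; [exact: cst_continuous|exact: cvg_id].
exact: exprn_continuous.
Qed.

Lemma measurable_pos5 : measurable_fun [set: R] pos5.
Proof. exact: continuous_measurable_fun continuous_pos5. Qed.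

(** Convexity: the left side is the tangent line to [y_+^5] at [z]. *)
Lemma pos5_tangent (z y : R) : 0 <= z -> 5 * z ^+ 4 * y - 4 * z ^+ 5 <= pos5 y.
Proof.
move=> z0; have [y0|y0] := leP 0 y.
  have -> : pos5 y = y ^+ 5 by rewrite /pos5 (max_idPr y0).
  rewrite -subr_ge0.
  have -> : y ^+ 5 - (5 * z ^+ 4 * y - 4 * z ^+ 5) =
    (y - z) ^+ 2 * (y ^+ 3 + 2 * y ^+ 2 * z + 3 * y * z ^+ 2 + 4 * z ^+ 3) by ring.
  by rewrite mulr_ge0 ?sqr_ge0// !addr_ge0 ?mulr_ge0 ?exprn_ge0// mulr_ge0.
apply: le_trans (pos5_ge0 _).
have z4 : 0 <= z ^+ 4 by rewrite exprn_ge0.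
have z5 : 0 <= z ^+ 5 by rewrite exprn_ge0.
nra.
Qed.

(** The tangent at [l x], evaluated at [x - t]; [l] stays free for later optimisation. *)
Lemma pos5_tangent_scaled (l t x : R) : 0 <= l -> 0 <= x ->
  (5 * l ^+ 4 - 4 * l ^+ 5) * x ^+ 5 - 5 * l ^+ 4 * t * x ^+ 4 <= pos5 (x - t).
Proof.
move=> l0 x0; apply: le_trans (pos5_tangent (x - t) (mulr_ge0 l0 x0)).
by rewrite le_eqVlt; apply/orP; left; apply/eqP; ring.
Qed.

Lemma pos5_convex (u v w : R) : u <= v <= w ->
  (w - u) * pos5 v <= (w - v) * pos5 u + (v - u) * pos5 w.
Proof.
move=> /andP[uv vw]; pose z := Num.max 0 v.
have z0 : 0 <= z by rewrite le_max lexx.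
(* The tangent at [z = v_+] touches the graph at [v], also when [v < 0] and [z = 0]. Weighting it at
   [u] and [w] gives the chord inequality. *)
have zE : 5 * z ^+ 4 * v - 4 * z ^+ 5 = z ^+ 5.
  rewrite /z; have [v0|v0] := leP 0 v; first by ring.
  by rewrite !expr0n/=; ring.
have hu : (w - v) * (5 * z ^+ 4 * u - 4 * z ^+ 5) <= (w - v) * pos5 u.
  by rewrite ler_wpM2l ?subr_ge0// pos5_tangent.
have hw : (v - u) * (5 * z ^+ 4 * w - 4 * z ^+ 5) <= (v - u) * pos5 w.
  by rewrite ler_wpM2l ?subr_ge0// pos5_tangent.
apply: le_trans (lerD hu hw); rewrite -[pos5 v]/(z ^+ 5) -[X in _ * X <= _]zE.
by rewrite le_eqVlt; apply/orP; left; apply/eqP; ring.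
Qed.

Lemma le_pos5 (x y : R) : x <= y -> pos5 x <= pos5 y.
Proof.
move=> xy; have h0 (z : R) : 0 <= Num.max 0 z by rewrite le_max lexx.
by rewrite /pos5 lerXn2r ?nnegrE ?h0// ge_max h0 le_max xy orbT.
Qed.

Lemma pos5_reflect (x : R) : x ^+ 5 + pos5 (- x) <= pos5 x.
Proof.
rewrite /pos5; case: (leP 0 x) => x0.
  rewrite (max_idPl _); last by rewrite oppr_le0.
  by rewrite expr0n/= addr0.
rewrite (max_idPr _); last by rewrite oppr_ge0 ltW.
by rewrite expr0n/= le_eqVlt; apply/orP; left; apply/eqP; ring.
Qed.

Lemma two_point_gauss_le (p t : R) : 0 <= p <= 1 ->
  ((p * pos5 (2 * (1 - p) - t) + (1 - p) * pos5 (- (2 * p) - t))%:E <=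
   \int[gauss]_z (pos5 (z - t))%:E)%E.
Proof.
move=> p01; set J := integral _ _ _.
have [->|Joo] := eqVneq J +oo%E; first by rewrite leey.
have J0 : (0 <= J)%E by apply: integral_ge0 => x _; rewrite lee_fin pos5_ge0.
have Jfin : J \is a fin_num by rewrite ge0_fin_numE// ltey.
have m5 : measurable_fun [set: R] (fun z => pos5 (z - t)).
  by apply: measurableT_comp; [exact: measurable_pos5|exact: measurable_funB].
have g5 x : 0 <= pos5 (x - t) by exact: pos5_ge0.
rewrite -(fineK Jfin) lee_fin.
apply: (@two_point_fifth_moment_le _ (8 * phi 0)) => //.
- by have := normal_pdf01_0_ge R; lra.
(* First family: the tangent bound at [x]; the nonnegative value at [- x] is discarded. *)
- move=> l /andP[l0 _]; rewrite -lee_fin fineK//.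
  have -> : l ^+ 4 * ((5 - 4 * l) * (8 * phi 0) - 15/2 * t) =
    1/2 * 0 + 1/2 * 0 + 3/2 * (- (5 * l ^+ 4 * t)) +
    8 * phi 0 * (5 * l ^+ 4 - 4 * l ^+ 5).
    by field.
  apply: integral_gauss_ge => // x x0.
  by have := pos5_tangent_scaled t l0 x0; have := g5 (- x); lra.
(* Second family: [(x - t)^5 + (- x - t)^5 = 2 (- t)^5 + 20 (- t)^3 x^2 + 10 (- t) x^4]. Of the
   reflected parts, [(x + t)_+^5] gets the tangent bound and [(t - x)_+^5] is discarded. *)
- move=> l /andP[l0 _]; rewrite -lee_fin fineK//.
  have -> : (- t) ^+ 5 + 10 * (- t) ^+ 3 + 15 * (- t) +
      l ^+ 4 * ((5 - 4 * l) * (8 * phi 0) + 15/2 * t) =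
    1/2 * (2 * (- t) ^+ 5) + 1/2 * (20 * (- t) ^+ 3) +
    3/2 * (10 * (- t) + 5 * l ^+ 4 * t) + 8 * phi 0 * (5 * l ^+ 4 - 4 * l ^+ 5).
    by field.
  apply: integral_gauss_ge => // x x0.
  have := pos5_tangent_scaled (- t) l0 x0.
  have := pos5_reflect (- x - t); have := pos5_reflect (x - t).
  have := pos5_ge0 (- (x - t)).
  rewrite (_ : - (- x - t) = x - - t); last by ring.
  lra.
Qed.
End two_point_comparison.

(** * The one-step bound at scale [s] and addition of Gaussian variances *)

Section one_step.
Variable R : realType.
Local Notation mu := (@lebesgue_measure R).
Local Notation phi := (normal_pdf (0:R) 1).
Local Notation gauss := (normal_prob (0:R) 1).

Lemma pos5M (c x : R) : 0 <= c -> pos5 (c * x) = c ^+ 5 * pos5 x.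
Proof. by move=> c0; rewrite /pos5 -[X in Num.max X _](mulr0 c) -maxr_pMr// exprMn. Qed.

(** The unit-scale bound made homogeneous: [p = - c / (2 s)] is the mass at [c + 2 s] of the centred
    law on [c] and [c + 2 s], and both sides are multiplied by [2 s]. *)
Lemma two_point_gauss_scaled_le (s c x : R) : 0 < s -> - (2 * s) <= c <= 0 ->
  (((c + 2 * s) * pos5 (x + c) + (- c) * pos5 (x + c + 2 * s))%:E <=
   (2 * s)%:E * \int[gauss]_z (pos5 (x + s * z))%:E)%E.
Proof.
move=> s0 /andP[cl c0].
pose p := - c / (2 * s); have p01 : 0 <= p <= 1.
  rewrite /p divr_ge0//=; [|lra|lra].
  by rewrite ler_pdivrMr; lra.
pose t := - x / s.
have := two_point_gauss_le t p01.
have s20 : 2 * s * s ^+ 5 > 0 by rewrite mulr_gt0 ?exprn_gt0//; lra.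
rewrite -(@lee_pmul2l _ (2 * s * s ^+ 5)%:E)//.
have -> : (((2 * s * s ^+ 5)%:E * \int[gauss]_z (pos5 (z - t))%:E) =
  ((2 * s)%:E * \int[gauss]_z (pos5 (x + s * z))%:E))%E.
  rewrite EFinM -muleA -ge0_integralZl//=; last 3 first.
  - apply/measurable_EFinP.
    by apply: measurableT_comp; [exact: measurable_pos5|exact: measurable_funB].
  - by move=> z _; rewrite lee_fin pos5_ge0.
  - by rewrite lee_fin exprn_ge0// ltW.
  congr (_ * _)%E; apply: eq_integral => z _.
  rewrite -EFinM -pos5M; last by lra.
  by rewrite /t; congr (pos5 _)%:E; field; lra.
apply: le_trans.
rewrite -EFinM lee_fin.
have Ex y : s ^+ 5 * pos5 y = pos5 (s * y) by rewrite pos5M//; lra.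
rewrite mulrDr.
have -> : 2 * s * s ^+ 5 * (p * pos5 (2 * (1 - p) - t)) =
   - c * (s ^+ 5 * pos5 (2 * (1 - p) - t)).
  by rewrite /p; field; lra.
have -> : 2 * s * s ^+ 5 * ((1 - p) * pos5 (- (2 * p) - t)) =
   (c + 2 * s) * (s ^+ 5 * pos5 (- (2 * p) - t)).
  by rewrite /p; field; lra.
rewrite !Ex addrC.
have -> : s * (- (2 * p) - t) = x + c by rewrite /p /t; field; lra.
have -> : s * (2 * (1 - p) - t) = x + c + 2 * s by rewrite /p /t; field; lra.
by [].
Qed.

(** The degenerate two-point law [c = 0]; an instance of Jensen's inequality. *)
Lemma pos5_gauss_le (s x : R) : 0 < s ->
  ((pos5 x)%:E <= \int[gauss]_z (pos5 (x + s * z))%:E)%E.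
Proof.
move=> s0.
have /two_point_gauss_scaled_le := s0 => /(_ 0 x).
rewrite lexx oppr_le0 add0r oppr0 mul0r addr0 addr0 andbT EFinM.
rewrite lee_pmul2l ?lte_fin//; last by lra.
by apply; lra.
Qed.

(* [(z, y) |-> (u, v)] with [c u = a y + b z], [c z = a v + b u] preserves
   [z^2 + y^2]. *)
Lemma normal_pdf01_rotate (a b c u z : R) : a != 0 -> c ^+ 2 = a ^+ 2 + b ^+ 2 ->
  phi z * phi ((c * u - b * z) / a) = phi u * phi ((c * z - b * u) / a).
Proof.
move=> a0 h; rewrite (normal_pdf01E z) (normal_pdf01E u).
rewrite (normal_pdf01E (_ / _)) (normal_pdf01E ((c * z - _) / _)).
rewrite !mulrA ![_ * phi 0]mulrAC -!mulrA -!expRD; congr (_ * (_ * expR _)).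
have E : z ^+ 2 + ((c * u - b * z) / a) ^+ 2 = u ^+ 2 + ((c * z - b * u) / a) ^+ 2.
  apply/eqP; rewrite -subr_eq0; apply/eqP.
  have -> : z ^+ 2 + ((c * u - b * z) / a) ^+ 2 - (u ^+ 2 + ((c * z - b * u) / a) ^+ 2) =
    (c ^+ 2 - (a ^+ 2 + b ^+ 2)) * (u ^+ 2 - z ^+ 2) / a ^+ 2 by field.
  by rewrite h subrr !mul0r.
lra.
Qed.

(** Substitute [u = (a y + b z) / c] in the inner integral, rotate the product of densities, and
    exchange the integrals; the one over [z] is then the total mass of a normal density. *)
Lemma gauss_convolution (F : R -> R) (a b c : R) : 0 < a -> 0 < c ->
  c ^+ 2 = a ^+ 2 + b ^+ 2 -> continuous F -> (forall x, 0 <= F x) ->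
  (\int[gauss]_z \int[gauss]_y (F (a * y + b * z))%:E =
   \int[gauss]_u (F (c * u))%:E)%E.
Proof.
move=> a0 c0 h cF F0.
have mF : measurable_fun [set: R] F by exact: continuous_measurable_fun.
have mp : measurable_fun [set: R] phi by exact: measurable_normal_pdf.
have cp : continuous phi by exact: continuous_normal_pdf.
have p0 x : 0 <= phi x by exact: normal_pdf_ge0.
have an0 : a != 0 by rewrite gt_eqF.
have cn0 : c != 0 by rewrite gt_eqF.
(* The joint integrand after substitution and rotation; [c / a] is the Jacobian. *)
pose K (z u : R) := F (c * u) * phi u * (phi ((c * z - b * u) / a) * (c / a)).
have K0 z u : 0 <= K z u.
  by rewrite /K !mulr_ge0// ?invr_ge0 ltW.
have mK : measurable_fun [set: (R * R)%type] (fun w : R * R => K w.1 w.2).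
  rewrite /K; apply: measurable_funM; first apply: measurable_funM.
  - apply: measurableT_comp => //; apply: measurable_funM => //.
  - exact: measurableT_comp.
  - apply: measurable_funM => //; apply: measurableT_comp => //.
    apply: measurable_funM => //; apply: measurable_funB; apply: measurable_funM => //.
have inner z : (\int[gauss]_y (F (a * y + b * z))%:E * (phi z)%:E =
   \int[mu]_u (K z u)%:E)%E.
  have mFz : measurable_fun [set: R] (fun y => F (a * y + b * z)).
    apply: measurableT_comp => //.
    by apply: measurable_funD => //; apply: measurable_funM.
  have mFzp : measurable_fun [set: R] (fun y => F (a * y + b * z) * phi y).
    exact: measurable_funM.
  rewrite integral_normal_prob; [|exact/measurable_EFinP|by move=> y; rewrite lee_fin].
  under eq_integral do rewrite -EFinM.
  rewrite -ge0_integralZr//; last 3 first.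
  - exact/measurable_EFinP.
  - by move=> y _; rewrite lee_fin mulr_ge0.
  - by rewrite lee_fin.
  under eq_integral do rewrite -!EFinM.
  have cG : continuous (fun y => F (a * y + b * z) * phi y * phi z).
    move=> y; apply: cvgM; last exact: cvg_cst.
    apply: cvgM; last exact: cp.
    apply: (@continuous_comp _ _ _ (fun y : R => a * y + b * z) F); last exact: cF.
    apply: cvgD; last exact: cvg_cst.
    by apply: cvgM; [exact: cvg_cst|exact: cvg_id].
  rewrite (@ge0_integral_affine _ _ (c / a) (- (b * z) / a)) ?divr_gt0//; last first.
    by move=> y; rewrite !mulr_ge0.
  apply: eq_integral => u _; congr EFin; rewrite /K.
  have -> : a * (c / a * u + - (b * z) / a) + b * z = c * u by field.
  have -> : c / a * u + - (b * z) / a = (c * u - b * z) / a by field.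
  have := normal_pdf01_rotate u z an0 h.
  move=> hr; rewrite -!mulrA; congr (_ * _).
  by rewrite mulrA [phi (_ / _) * _]mulrC hr -!mulrA.
have mFw : measurable_fun [set: (R * R)%type]
    (fun w : R * R => (F (a * w.2 + b * w.1))%:E).
  apply/measurable_EFinP; apply: measurableT_comp => //.
  by apply: measurable_funD; apply: measurable_funM.
rewrite integral_normal_prob; last 2 first.
- apply: (measurable_fun_fubini_tonelli_F (m2 := gauss)
    (fun w : R * R => (F (a * w.2 + b * w.1))%:E)) => //.
  by move=> w; rewrite lee_fin.
- by move=> z; apply: integral_ge0 => y _; rewrite lee_fin.
transitivity (\int[mu]_z \int[mu]_u (K z u)%:E)%E.
  by apply: eq_integral => z _; rewrite inner.
have -> : (\int[mu]_z \int[mu]_u (K z u)%:E = \int[mu]_u \int[mu]_z (K z u)%:E)%E.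
  apply: (fubini_tonelli (m1 := mu) (m2 := mu) (fun w : R * R => (K w.1 w.2)%:E)).
    exact/measurable_EFinP.
  by move=> x; rewrite lee_fin.
rewrite integral_normal_prob; last 2 first.
- by apply/measurable_EFinP; apply: measurableT_comp => //; exact: measurable_funM.
- by move=> x; rewrite lee_fin.
apply: eq_integral => u _; rewrite /K /=.
under eq_integral do rewrite EFinM.
rewrite ge0_integralZl//; last 3 first.
- apply/measurable_EFinP; apply: measurable_funM => //; apply: measurableT_comp => //.
  by apply: measurable_funM => //; apply: measurable_funB => //; apply: measurable_funM.
- by move=> z _; rewrite lee_fin mulr_ge0// divr_ge0// ltW.
- by rewrite lee_fin mulr_ge0.
under eq_integral => z _.
  rewrite (_ : (c * z - b * u) / a = c / a * z + (- (b * u) / a)); last by field.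
  over.
rewrite -(@ge0_integral_affine _ phi)// ?divr_gt0//.
by rewrite integral_normal_pdf mule1 EFinM.
Qed.
(* A slope [k >= 0] with [(x + y)_+^5 <= E (x + s Z)_+^5 + k y] for
   [c <= y <= c + 2 s]: it is the slope of the chord when [0] lies between the
   endpoints. The last case only concerns a null event, but giving it a slope
   too makes the bound hold pointwise. *)
Definition chord_slope (s x c : R) : R :=
  if c < - (2 * s) then 0
  else if c <= 0 then (pos5 (x + c + 2 * s) - pos5 (x + c)) / (2 * s)
  else pos5 (x + c + 2 * s) * c `^ (-1).

Lemma chord_slope_ge0 s x c : 0 < s -> 0 <= chord_slope s x c.
Proof.
move=> s0; rewrite /chord_slope; case: ifP => // _; case: ifP => _.
  rewrite divr_ge0// ?subr_ge0 ?le_pos5//; lra.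
by rewrite mulr_ge0 ?pos5_ge0 ?powR_ge0.
Qed.

Lemma pos5_le_chord s x c y : 0 < s -> c <= y -> y <= c + 2 * s ->
  ((pos5 (x + y))%:E <=
   \int[normal_prob 0 1]_z (pos5 (x + s * z))%:E + (chord_slope s x c * y)%:E)%E.
Proof.
move=> s0 cy yc; rewrite /chord_slope; case: (ltP c) => cs.
  (* Here [y <= c + 2 s < 0], so monotonicity is enough. *)
  rewrite mul0r adde0; apply: le_trans (pos5_gauss_le _ s0).
  by rewrite lee_fin le_pos5//; lra.
case: (leP c 0) => c0.
  have s20 : 0 < 2 * s by lra.
  set J := integral _ _ _.
  have [->|Joo] := eqVneq J +oo%E; first by rewrite addye// leey.
  have J0 : (0 <= J)%E by apply: integral_ge0 => z _; rewrite lee_fin pos5_ge0.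
  have Jfin : J \is a fin_num by rewrite ge0_fin_numE// ltey.
  have := @two_point_gauss_scaled_le s c x s0; rewrite -/J cs c0 => /(_ isT).
  rewrite -(fineK Jfin) -EFinM -EFinD !lee_fin => h.
  (* The chord at [y] is its value at 0 plus slope times [y], and its value at 0 is the two-point
     mean bounded in [h]. *)
  have hc := @pos5_convex R (x + c) (x + y) (x + c + 2 * s).
  have {}hc := hc _; rewrite (_ : _ <= _ <= _) in hc; last by apply/andP; split; lra.
  have {}hc := hc isT.
  rewrite -(ler_pM2l s20) mulrDr.
  have -> : 2 * s * ((pos5 (x + c + 2 * s) - pos5 (x + c)) / (2 * s) * y) =
    (pos5 (x + c + 2 * s) - pos5 (x + c)) * y by field; lra.
  lra.
(* Here [y >= c > 0], so the slope term alone dominates. *)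
rewrite -[leLHS]add0e; apply: leeD.
  by apply: integral_ge0 => z _; rewrite lee_fin pos5_ge0.
rewrite lee_fin powR_inv1; last exact: ltW.
apply: (@le_trans _ _ (pos5 (x + c + 2 * s))); first by rewrite le_pos5//; lra.
rewrite -mulrA ler_peMr ?pos5_ge0//.
by rewrite mulrC ler_pdivlMr// mul1r.
Qed.

End one_step.

(** * Integrating the one-step bound given a sub-sigma-algebra *)

Section sub_sigma_algebra.
Context d (T : measurableType d) (R : realType).
Variables (G : set (set T)) (hG : sigma_algebra [set: T] G)
  (GM : G `<=` measurable).
Local Notation T' := (g_sigma_algebraType G).

Lemma sub_measurable_set (A : set T') : measurable A -> G A.
Proof. by rewrite /measurable/= sigma_algebra_id. Qed.

Lemma sub_measurable_fun (f : T -> R) :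
  sub_measurable G f -> measurable_fun [set: T] f.
Proof.
move=> mf _ B mB; apply: GM.
by have /sub_measurable_set := mf measurableT B mB.
Qed.

Variable P : probability T R.

(** Write [lam] as the length of [[0, lam[] and apply Tonelli. *)
Lemma integral_layer_cake (f lam : T -> R) : measurable_fun [set: T] f ->
  (forall w, 0 <= f w) -> sub_measurable G lam -> (forall w, 0 <= lam w) ->
  (\int[P]_w (lam w * f w)%:E =
   \int[@lebesgue_measure R]_(u in `[0%R, +oo[)
     \int[P]_(w in [set w | (u < lam w)%R]) (f w)%:E)%E.
Proof.
move=> mf f0 slam l0.
have mlam := sub_measurable_fun slam.
pose k (w : T) (u : R) := f w * (if (0 <= u) && (u < lam w) then 1 else 0).
have k0 w u : 0 <= k w u by rewrite /k; case: ifPn; rewrite ?mulr1 ?mulr0.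
have mk : measurable_fun [set: (T * R)%type] (fun x : T * R => (k x.1 x.2)%:E).
  apply/measurable_EFinP; apply: measurable_funM; first exact: measurableT_comp.
  apply: measurable_fun_ifT => //.
  apply: measurable_and; first exact: measurable_fun_ler.
  by apply: measurable_fun_ltr => //; exact: measurableT_comp.
transitivity (\int[P]_w \int[lebesgue_measure]_u (k w u)%:E)%E.
  apply: eq_integral => w _; rewrite /k.
  under eq_integral do rewrite EFinM.
  rewrite ge0_integralZl//; last 3 first.
  - apply/measurable_EFinP; apply: measurable_fun_ifT => //.
    by apply: measurable_and; [exact: measurable_fun_ler|exact: measurable_fun_ltr].
  - by move=> u _; rewrite lee_fin; case: ifPn.
  - by rewrite lee_fin.
  rewrite mulrC EFinM; congr (_ * _)%E.
  under eq_integral => u _.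
    rewrite (_ : (if _ then 1 else 0) = \1_`[0, lam w[ u); last first.
      by rewrite indicE mem_setE in_itv/=; case: ifP.
    over.
  rewrite integral_indic// setIT; apply/esym/(etrans (lebesgue_measure_itv _)).
  rewrite /= lte_fin.
  have [_|] := ltP 0 (lam w); first by rewrite oppr0 adde0.
  by move=> h; congr EFin; apply/eqP; rewrite eq_le h l0.
rewrite (fubini_tonelli (m1 := P) (m2 := lebesgue_measure)
  (fun x : T * R => (k x.1 x.2)%:E))//; last by move=> x; rewrite lee_fin.
rewrite [RHS]integral_mkcond; apply: eq_integral => u _.
rewrite patchE mem_setE in_itv/= andbT.
case: ifPn => u0; last first.
  by apply: integral0_eq => w _; rewrite /k (negbTE u0) mulr0.
rewrite [RHS]integral_mkcond; apply: eq_integral => w _.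
rewrite patchE /k u0/=; case: ifPn => h.
  by rewrite mem_set// mulr1.
by rewrite mulr0 memNset//=; exact/negP.
Qed.

(** Extends an inequality from sets of [G] to nonnegative [G]-measurable weights: the level sets of
    [lam] lie in [G]. *)
Lemma le_integral_sub_weight (f1 f2 lam : T -> R) :
  measurable_fun [set: T] f1 -> (forall w, 0 <= f1 w) ->
  measurable_fun [set: T] f2 -> (forall w, 0 <= f2 w) ->
  (forall A, G A -> (\int[P]_(w in A) (f1 w)%:E <= \int[P]_(w in A) (f2 w)%:E)%E) ->
  sub_measurable G lam -> (forall w, 0 <= lam w) ->
  (\int[P]_w (lam w * f1 w)%:E <= \int[P]_w (lam w * f2 w)%:E)%E.
Proof.
move=> mf1 f10 mf2 f20 f12 slam l0; rewrite !integral_layer_cake//.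
have GA u : G [set w | u < lam w].
  apply: sub_measurable_set.
  have := @measurable_fun_ltr _ T' R setT (cst u) lam (measurable_cst _) slam.
  by move=> /(_ measurableT [set true] I); rewrite setTI.
have mk (f : T -> R) : measurable_fun [set: T] f -> (forall w, 0 <= f w) ->
    measurable_fun [set: R]
      (fun u : R => \int[P]_(w in [set w | (u < lam w)%R]) (f w)%:E)%E.
  move=> mf f0.
  have mlam := sub_measurable_fun slam.
  pose k (w : T * R) := f w.1 * (if w.2 < lam w.1 then 1 else 0).
  have mk : measurable_fun [set: (T * R)%type] (fun x => (k x)%:E).
    apply/measurable_EFinP; apply: measurable_funM; first exact: measurableT_comp.
    apply: measurable_fun_ifT => //.
    by apply: measurable_fun_ltr => //; exact: measurableT_comp.
  have k0 x : (0 <= (k x)%:E)%E.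
    by rewrite lee_fin /k; case: ifPn; rewrite ?mulr1 ?mulr0.
  have := measurable_fun_fubini_tonelli_G (m1 := P) (fun x => (k x)%:E) mk k0.
  congr (measurable_fun _ _); apply/funext => u; rewrite /fubini_G.
  rewrite [RHS]integral_mkcond; apply: eq_integral => w _.
  rewrite patchE /k /=; case: ifPn => h.
    by rewrite mem_set// mulr1.
  by rewrite mulr0 memNset//=; exact/negP.
apply: ge0_le_integral => //.
- by move=> u _; apply: integral_ge0 => w _; rewrite lee_fin.
- by apply: measurable_funTS; exact: mk.
- by apply: measurable_funTS; exact: mk.
- by move=> u _; exact: f12.
Qed.

(** Integrate the pointwise chord bound. The slope is nonnegative and [G]-measurable, so slope times
    increment should have nonpositive mean; as this product need not be integrable, the slope is
    truncated first. *)
Lemma martingale_step (X0 X1 C : T -> R) (s t : R) : 0 < s ->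
  sub_measurable G X0 -> sub_measurable G C ->
  P.-integrable [set: T] (EFin \o X0) -> P.-integrable [set: T] (EFin \o X1) ->
  (forall A, G A -> (\int[P]_(w in A) (X1 w)%:E <= \int[P]_(w in A) (X0 w)%:E)%E) ->
  {ae P, forall w, C w <= X1 w - X0 w /\ X1 w - X0 w <= C w + 2 * s} ->
  (\int[P]_w (pos5 (X1 w - t))%:E <=
   \int[P]_w \int[normal_prob 0 1]_z (pos5 (X0 w - t + s * z))%:E)%E.
Proof.
move=> s0 sX0 sC iX0 iX1 hX hC.
have mX0 := sub_measurable_fun sX0.
have mX1 : measurable_fun [set: T] X1.
  by apply/measurable_EFinP; exact: measurable_int iX1.
pose X w := X1 w - X0 w.
have mX : measurable_fun [set: T] X by exact: measurable_funB.
have iX : P.-integrable [set: T] (EFin \o X).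
  have := integrableB measurableT iX1 iX0.
  by apply: eq_integrable => // w _; rewrite /= EFinB.
(* The layer-cake comparison handles nonnegative functions, so the mean condition is stated as [Xp]
   against [Xm]. *)
pose Xp := X^\+%R; pose Xm := X^\-%R.
have mXp : measurable_fun [set: T] Xp by exact: measurable_funrpos.
have mXm : measurable_fun [set: T] Xm by exact: measurable_funrneg.
have Xp0 w : 0 <= Xp w by exact: funrpos_ge0.
have Xm0 w : 0 <= Xm w by exact: funrneg_ge0.
have XE w : X w = Xp w - Xm w.
  by rewrite -[in LHS](funrposBneg X).
have iXp : P.-integrable [set: T] (EFin \o Xp).
  have := integrable_funepos measurableT iX.
  by apply: eq_integrable => // w _; rewrite funeposE /= -EFin_max.
have iXm : P.-integrable [set: T] (EFin \o Xm).
  have := integrable_funeneg measurableT iX.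
  by apply: eq_integrable => // w _; rewrite funenegE /= -EFin_max.
have hpm A : G A -> (\int[P]_(w in A) (Xp w)%:E <= \int[P]_(w in A) (Xm w)%:E)%E.
  move=> GA; have mA := GM GA.
  have iS (h : T -> R) :
      P.-integrable [set: T] (EFin \o h) -> P.-integrable A (EFin \o h).
    exact: integrableS.
  have : (\int[P]_(w in A) (X w)%:E <= 0)%E.
    under eq_integral do rewrite EFinB.
    rewrite integralB//; [|exact: iS|exact: iS].
    by rewrite sube_le0 hX.
  under eq_integral do rewrite XE EFinB.
  rewrite integralB//; [|exact: iS|exact: iS].
  by rewrite sube_le0.
pose g w := (\int[normal_prob 0 1]_z (pos5 (X0 w - t + s * z))%:E)%E.
have g0 w : (0 <= g w)%E by apply: integral_ge0 => z _; rewrite lee_fin pos5_ge0.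
have mg : measurable_fun [set: T] g.
  apply: (measurable_fun_fubini_tonelli_F (m2 := normal_prob 0 1)
    (fun x : T * R => (pos5 (X0 x.1 - t + s * x.2))%:E)).
    apply/measurable_EFinP; apply: measurableT_comp; first exact: measurable_pos5.
    apply: measurable_funD; last exact: measurable_funM.
    by apply: measurable_funB => //; exact: measurableT_comp.
  by move=> x; rewrite lee_fin pos5_ge0.
pose lam w := chord_slope s (X0 w - t) (C w).
have slam : sub_measurable G lam.
  have m5 := @measurable_pos5 R.
  rewrite /sub_measurable /lam /chord_slope.
  have m1 : measurable_fun [set: T'] (fun w => pos5 (X0 w - t + C w) : R).
    apply: measurableT_comp => //; apply: measurable_funD => //.
    exact: measurable_funB.
  have m2 : measurable_fun [set: T'] (fun w => pos5 (X0 w - t + C w + 2 * s) : R).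
    apply: measurableT_comp => //; apply: measurable_funD => //.
    by apply: measurable_funD => //; exact: measurable_funB.
  apply: measurable_fun_ifT => //; first exact: measurable_fun_ltr.
  apply: measurable_fun_ifT; first exact: measurable_fun_ler.
    by apply: measurable_funM => //; exact: measurable_funB.
  apply: measurable_funM => //.
  apply: (@measurableT_comp _ _ _ _ _ _ (fun c : R => c `^ (-1))) => //.
have l0 w : 0 <= lam w by exact: chord_slope_ge0.
have mlam := sub_measurable_fun slam.
pose A n := [set w | lam w <= n%:R].
have mA n : measurable (A n).
  have := measurable_fun_le (g := fun=> n%:R : R) measurableT mlam (measurable_cst _).
  by rewrite setTI.
have mY : measurable_fun [set: T] (fun w => (pos5 (X1 w - t))%:E).
  apply/measurable_EFinP; apply: measurableT_comp; first exact: measurable_pos5.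
  exact: measurable_funB.
have key n : (\int[P]_(w in A n) (pos5 (X1 w - t))%:E <= \int[P]_w g w)%E.
  pose ln w := if lam w <= n%:R then lam w else 0.
  have ln0 w : 0 <= ln w by rewrite /ln; case: ifP.
  have lnn w : ln w <= n%:R by rewrite /ln; case: ifP.
  have sln : sub_measurable G ln.
    by apply: measurable_fun_ifT => //; exact: measurable_fun_ler.
  have mln := sub_measurable_fun sln.
  have mlp : measurable_fun [set: T] (fun w => (ln w * Xp w)%:E).
    by apply/measurable_EFinP; exact: measurable_funM.
  have mlm : measurable_fun [set: T] (fun w => (ln w * Xm w)%:E).
    by apply/measurable_EFinP; exact: measurable_funM.
  have weight := le_integral_sub_weight mXp Xp0 mXm Xm0 hpm sln ln0.
  have Jfin : (\int[P]_w (ln w * Xm w)%:E)%E \is a fin_num.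
    apply: integrable_fin_num => //.
    have := integrableZl measurableT n%:R iXm.
    apply: le_integrable => // w _.
    rewrite -[X in (_ <= `|X|)%E]EFinM !gee0_abs ?lee_fin ?mulr_ge0//.
    by rewrite ler_wpM2r.
  (* Adding the finite integral of [ln * Xm] to both sides avoids any subtraction of integrals. *)
  rewrite -(leeD2rE _ _ Jfin).
  apply: (@le_trans _ _ (\int[P]_w g w + \int[P]_w (ln w * Xp w)%:E)%E); last first.
    exact: leeD2l.
  have ind0 w : (0 <= ((fun w => (pos5 (X1 w - t))%:E) \_ (A n)) w)%E.
    by rewrite patchE; case: ifP => // _; rewrite lee_fin pos5_ge0.
  have mind : measurable_fun [set: T] ((fun w => (pos5 (X1 w - t))%:E) \_ (A n)).
    by apply/(measurable_restrictT _ _).1 => //; exact: measurable_funTS.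
  have lp0 w : (0 <= (ln w * Xp w)%:E)%E by rewrite lee_fin mulr_ge0.
  have lm0 w : (0 <= (ln w * Xm w)%:E)%E by rewrite lee_fin mulr_ge0.
  rewrite integral_mkcond -!ge0_integralD//.
  apply: ae_ge0_le_integral => //.
  - by move=> w _; rewrite adde_ge0.
  - exact: emeasurable_funD.
  - by move=> w _; rewrite adde_ge0.
  - exact: emeasurable_funD.
  apply: filterS hC => w [h1 h2] _.
  rewrite patchE; case: ifPn => wA; last first.
    rewrite /ln ifF; last by apply/negbTE; rewrite notin_setE in wA; apply/negP.
    by rewrite !mul0r add0e adde0.
  have -> : ln w = lam w by rewrite /ln ifT//; rewrite inE in wA.
  have := pos5_le_chord (X0 w - t) s0 h1 h2.
  have -> : X0 w - t + (X1 w - X0 w) = X1 w - t by ring.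
  rewrite -/(g w) -/(lam w) -/(X w) XE mulrBr => h.
  apply: (@le_trans _ _ (g w + (lam w * Xp w - lam w * Xm w)%:E + (lam w * Xm w)%:E)%E).
    exact: leeD2r.
  by rewrite -addeA -EFinD subrK.
have : (\int[P]_(w in A n) (pos5 (X1 w - t))%:E @[n --> \oo] -->
    \int[P]_(w in \bigcup_n A n) (pos5 (X1 w - t))%:E)%E.
  apply: ge0_nondecreasing_set_cvg_integral => //.
  - move=> m n mn; apply/subsetPset => w /= h; apply: (le_trans h).
    by rewrite ler_nat.
  - by move=> n; exact: measurable_funTS.
  - by move=> n w _; rewrite lee_fin pos5_ge0.
(* The truncation is removed by monotone convergence, as [lam] is real-valued. *)
have -> : \bigcup_n A n = [set: T].
  apply/seteqP; split => // w _; exists (Num.bound (lam w)) => //.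
  by rewrite /A/=; apply: ltW; apply: archi_boundP.
move=> cv; rewrite -(cvg_lim _ cv)//; apply: lime_le.
  by apply/cvg_ex; eexists; exact: cv.
by apply: nearW => n; exact: key.
Qed.
End sub_sigma_algebra.

(** * Sigma-finiteness of the mixing measure, induction on [n], and conclusion *)

Lemma fubini_tonelli_sigma_finite d1 d2 (T1 : measurableType d1) (T2 : measurableType d2)
  (R : realType) (m1 : {sigma_finite_measure set T1 -> \bar R})
  (m2 : {measure set T2 -> \bar R}) (f : T1 * T2 -> \bar R) :
  sigma_finite [set: T2] m2 ->
  measurable_fun setT f -> (forall x, 0 <= f x)%E ->
  measurable_fun setT (fun x => \int[m2]_y f (x, y))%E /\
  (\int[m1]_x \int[m2]_y f (x, y) = \int[m2]_y \int[m1]_x f (x, y))%E.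
Proof.
move=> fin mf f0.
pose m : {sigma_finite_measure set T2 -> \bar R} :=
  HB.pack (m2 : set T2 -> \bar R) (Measure.class m2)
    (@isSFinite.Build _ _ _ m2 (sfinite_measure_sigma_finite fin))
    (@isSigmaFinite.Build _ _ _ m2 fin).
split; first exact: (@measurable_fun_fubini_tonelli_F _ _ _ _ _ m f mf f0).
exact: (fubini_tonelli (m1 := m1) (m2 := m) f mf f0).
Qed.

Lemma pospow_5 (R : realType) (x : R) : pospow 5 x = pos5 x.
Proof.
rewrite /pospow /pos5 /pospart; case: eqP => [->|_]; first by rewrite expr0n.
by rewrite (powR_mulrn 5)// le_max lexx.
Qed.

(** [(n + 1 - t)_+^5 >= 1] for [t <= n], so the half-line up to [n] has mass at most [f (n + 1)].
    This justifies Tonelli for [mu]. *)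
Lemma Fplus5_sigma_finite (R : realType) (f : R -> R)
    (mu : {measure set (measurableTypeR R) -> \bar R}) :
  (forall x, (f x)%:E = \int[mu]_t (pos5 (x - t))%:E)%E ->
  sigma_finite [set: measurableTypeR R] mu.
Proof.
move=> hf; exists (fun n => `]-oo, n%:R]%classic).
  apply/esym/seteqP; split => // x _; exists (Num.bound `|x|) => //=.
  rewrite in_itv/= (le_trans (ler_norm x))//.
  by apply: ltW; exact: archi_boundP.
move=> n; split; first exact: measurable_itv.
apply: (@le_lt_trans _ _ (f (n%:R + 1))%:E); last exact: ltry.
rewrite hf -[X in mu X]setIT -integral_indic//.
apply: ge0_le_integral => //.
- by apply/measurable_EFinP; exact: measurable_indic.
- apply/measurable_EFinP; apply: measurableT_comp; first exact: measurable_pos5.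
  exact: measurable_funB.
- move=> x _; rewrite lee_fin indicE mem_setE in_itv/=.
  case: (leP x n%:R) => xn; last exact: pos5_ge0.
  rewrite /pos5 (max_idPr _); last by lra.
  by rewrite -[leLHS](expr1n _ 5) lerXn2r ?nnegrE; lra.
Qed.

Lemma cond_expectation_le d (T : measurableType d) (R : realType)
    (P : probability T R) (G : set (set T)) (X Y Z : T -> R) :
  G `<=` measurable ->
  P.-integrable [set: T] (EFin \o Z) ->
  is_cond_expectation P G X Y -> {ae P, forall w, Y w <= Z w} ->
  forall A, G A -> (\int[P]_(w in A) (X w)%:E <= \int[P]_(w in A) (Z w)%:E)%E.
Proof.
move=> GM iZ [_ iY YX] YZ A GA; have mA := GM _ GA.
rewrite -YX//.
have iS (h : T -> R) : P.-integrable [set: T] (EFin \o h) -> P.-integrable A (EFin \o h).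
  exact: integrableS.
rewrite -sube_ge0; last by rewrite integrable_fin_num//; exact: iS.
rewrite -integralB//; [|exact: iS|exact: iS].
have mY := measurable_int _ iY; have mZ := measurable_int _ iZ.
have mB : measurable_fun A (fun w => (Z w)%:E - (Y w)%:E)%E.
  by apply: measurable_funTS; exact: emeasurable_funB.
(* Almost surely the difference equals its absolute value, which is nonnegative everywhere. *)
rewrite (@ae_eq_integral _ _ _ P A (fun w => `|(Z w)%:E - (Y w)%:E|)%E)//.
- exact: integral_ge0.
- exact: measurableT_comp.
- by apply: filterS YZ => w h _; rewrite gee0_abs// sube_ge0// lee_fin.
Qed.

Lemma pos5_supermartingale_le (R : realType)
    (d : measure_display) (T : measurableType d) (P : probability T R)
    (H : nat -> set (set T)) (S : nat -> T -> R) (s : nat -> R) (n : nat) (t : R) :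
  is_filtration H -> supermartingale P H S ->
  {ae P, forall w, S 0%N w <= 0} ->
  (forall i : nat, (1 <= i)%N ->
     0 < s i /\
     exists C D : T -> R,
       [/\ sub_measurable (H i.-1) C, sub_measurable (H i.-1) D
         & {ae P, forall w,
             [/\ C w <= S i w - S i.-1 w, S i w - S i.-1 w <= D w
               & D w - C w <= 2 * s i]}]) ->
  (\int[P]_w (pos5 (S n w - t))%:E <=
   \int[normal_prob 0 1]_z
     (pos5 (Num.sqrt (\sum_(1 <= i < n.+1) s i ^+ 2) * z - t))%:E)%E.
Proof.
move=> hH hS hS0 hX; pose sg k := Num.sqrt (\sum_(1 <= i < k.+1) s i ^+ 2).
rewrite -/(sg n).
have [sH HM _] := hH; have [mS iS cS] := hS.
have mSn k : measurable_fun [set: T] (S k).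
  exact: (sub_measurable_fun (sH k) (HM k) (mS k)).
have m5 := @measurable_pos5 R.
(* [t] is generalised because the induction hypothesis is used at [t - s_(n+1) z] for each Gaussian
   value [z]. *)
elim: n t => [|n IH] t.
  have sg0 : sg 0 = 0 by rewrite /sg big_geq// sqrtr0.
  under [leRHS]eq_integral do rewrite sg0 mul0r add0r.
  rewrite integral_cst//= probability_setT mule1.
  rewrite -[leRHS]mule1 -(probability_setT P) -integral_cst//.
  apply: ae_ge0_le_integral => //.
  - by move=> w _; rewrite lee_fin pos5_ge0.
  - by apply/measurable_EFinP; apply: measurableT_comp => //; exact: measurable_funB.
  - by move=> w _; rewrite lee_fin pos5_ge0.
  - by apply: filterS hS0 => w h _; rewrite lee_fin le_pos5//; lra.
have [s0 [C [D [mC _ hCD]]]] := hX n.+1 isT.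
have [Y cY YS] := cS n.
have step := @martingale_step _ T R (H n) (sH n) (HM n) P (S n) (S n.+1) C (s n.+1) t s0
  (mS n) mC (iS n) (iS n.+1) (cond_expectation_le (HM n) (iS n) cY YS).
apply: (le_trans (step _)).
  by apply: filterS hCD => w /= [h1 h2 h3]; split => //; lra.
have mk : measurable_fun [set: (T * R)%type]
    (fun x : T * R => (pos5 (S n x.1 - t + s n.+1 * x.2))%:E).
  apply/measurable_EFinP; apply: measurableT_comp => //.
  apply: measurable_funD; last exact: measurable_funM.
  by apply: measurable_funB => //; exact: measurableT_comp.
have k0 x : (0 <= (pos5 (S n x.1 - t + s n.+1 * x.2))%:E)%E.
  by rewrite lee_fin pos5_ge0.
rewrite (fubini_tonelli (m1 := P) (m2 := normal_prob 0 1)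
  (fun x : T * R => (pos5 (S n x.1 - t + s n.+1 * x.2))%:E))//.
have sgS : sg n.+1 ^+ 2 = sg n ^+ 2 + s n.+1 ^+ 2.
  have sum0 k : 0 <= \sum_(1 <= i < k) s i ^+ 2 by apply: sumr_ge0 => i _; exact: sqr_ge0.
  by rewrite /sg !sqr_sqrtr// big_nat_recr.
have cF : continuous (fun x : R => pos5 (x - t)).
  move=> x; apply: (@continuous_comp _ _ _ (fun x : R => x - t) (@pos5 R)).
    by apply: cvgB; [exact: cvg_id|exact: cvg_cst].
  exact: continuous_pos5.
have sgS0 : 0 < sg n.+1.
  rewrite lt0r sqrtr_ge0 andbT -sqrf_eq0 sgS gt_eqF//.
  by rewrite ltr_wpDl ?sqr_ge0// exprn_gt0.
apply: (@le_trans _ _ (\int[normal_prob 0 1]_z \int[normal_prob 0 1]_y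
    (pos5 (sg n * y + s n.+1 * z - t))%:E)%E).
  apply: ge0_le_integral => //.
  - by move=> z _; apply: integral_ge0.
  - exact: (measurable_fun_fubini_tonelli_G (m1 := P)
     (fun x : T * R => (pos5 (S n x.1 - t + s n.+1 * x.2))%:E)).
  - apply: (measurable_fun_fubini_tonelli_F (m2 := normal_prob 0 1)
     (fun x : R * R => (pos5 (sg n * x.2 + s n.+1 * x.1 - t))%:E)).
      apply/measurable_EFinP; apply: measurableT_comp => //.
      by apply: measurable_funB => //; apply: measurable_funD; apply: measurable_funM.
    by move=> x; rewrite lee_fin pos5_ge0.
  - move=> z _.
    have := IH (t - s n.+1 * z).
    under eq_integral do rewrite opprB addrA addrAC.
    under [X in (_ <= X)%E -> _]eq_integral do rewrite opprB addrA.
    by [].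
(* The convolution identity needs a positive first scale; a zero scale, as at [n = 0], makes the
   inner integral constant. *)
have [sgn0|sgn0] := eqVneq (sg n) 0.
  have sE : sg n.+1 = s n.+1.
    apply/eqP; rewrite -(@eqrXn2 _ 2)//; [|exact: ltW|exact: ltW].
    by rewrite sgS sgn0 expr0n add0r.
  rewrite le_eqVlt; apply/orP; left; apply/eqP.
  apply: eq_integral => z _; under eq_integral do rewrite sgn0 mul0r add0r.
  by rewrite integral_cst//= probability_setT mule1 sE.
rewrite (@gauss_convolution R (fun x => pos5 (x - t)) (sg n) (s n.+1) (sg n.+1))//.
- by rewrite lt0r sgn0 sqrtr_ge0.
- by move=> x; exact: pos5_ge0.
Qed.

Theorem theorem2p1 (R : realType)
    (d : measure_display) (T : measurableType d) (P : probability T R)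
    (H : nat -> set (set T)) (S : nat -> T -> R) (s : nat -> R)
    (d' : measure_display) (T' : measurableType d') (Q : probability T' R)
    (Z : {RV Q >-> R})
    (hH : is_filtration H)
    (hS : supermartingale P H S)
    (hS0 : {ae P, forall w, S 0%N w <= 0})
    (hX : forall i : nat, (1 <= i)%N ->
       0 < s i /\
       exists C D : T -> R,
         [/\ sub_measurable (H i.-1) C, sub_measurable (H i.-1) D
           & {ae P, forall w,
               [/\ C w <= S i w - S i.-1 w, S i w - S i.-1 w <= D w
                 & D w - C w <= 2 * s i]}])
    (hZ : standard_normal Z)
    (f : R -> R) (hf : Fplus 5 f) (n : nat) (hn : (1 <= n)%N) :
  let sn := Num.sqrt (\sum_(1 <= i < n.+1) s i ^+ 2) in
  ('E_P[(fun w => f (S n w))%R] <= 'E_Q[(fun w => f (sn * Z w))%R])%E.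
Proof.
cbv zeta; set sn := Num.sqrt _; have [mu hmu] := hf.
have fE x : (f x)%:E = (\int[mu]_t (pos5 (x - t))%:E)%E.
  by rewrite hmu; apply: eq_integral => t _; rewrite pospow_5.
have fin := Fplus5_sigma_finite fE.
have [sH HM _] := hH; have [mS _ _] := hS.
have mSn : measurable_fun [set: T] (S n).
  exact: (sub_measurable_fun (sH n) (HM n) (mS n)).
have m5 := @measurable_pos5 R.
(* Tonelli for an arbitrary variable, applied both to [S n] under [P] and to [sn * z] under the
   normal law. *)
have mixture d1 (T1 : measurableType d1) (m1 : {sigma_finite_measure set T1 -> \bar R})
    (X : T1 -> R) : measurable_fun [set: T1] X ->
    [/\ measurable_fun [set: T1] (fun w => (f (X w))%:E),
    measurable_fun [set: measurableTypeR R] (fun t => \int[m1]_w (pos5 (X w - t))%:E)%E &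
    (\int[m1]_w (f (X w))%:E = \int[mu]_t \int[m1]_w (pos5 (X w - t))%:E)%E].
  move=> mX.
  have mk : measurable_fun [set: (T1 * measurableTypeR R)%type]
      (fun x : T1 * measurableTypeR R => (pos5 (X x.1 - x.2))%:E).
    apply/measurable_EFinP; apply: measurableT_comp => //.
    by apply: measurable_funB => //; exact: measurableT_comp.
  have k0 (x : T1 * measurableTypeR R) : (0 <= (pos5 (X x.1 - x.2))%:E)%E.
    by rewrite lee_fin pos5_ge0.
  have [h1 h2] := fubini_tonelli_sigma_finite m1 fin mk k0.
  split; first by under eq_fun do rewrite fE.
    exact: (measurable_fun_fubini_tonelli_G (m1 := m1) _ mk k0).
  by under eq_integral do rewrite fE.
have f0 x : (0 <= (f x)%:E)%E.
  by rewrite fE; apply: integral_ge0 => t _; rewrite lee_fin pos5_ge0.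
rewrite unlock /=; have [_ mP ->] := mixture _ _ P _ mSn.
have msn : measurable_fun [set: R] (fun z => sn * z) by exact: measurable_funM.
have [mfs mg eg] := mixture _ _ (normal_prob (0 : R) 1) _ msn.
have -> : (\int[Q]_w (f (sn * Z w))%:E)%E =
    (\int[normal_prob 0 1]_z (f (sn * z))%:E)%E.
  have mZ : measurable_fun [set: T'] (Z : T' -> measurableTypeR R).
    exact: (@measurable_funPT _ _ _ _ Z).
  (* [Z] is repackaged so that its codomain carries the measurable structure on which the normal law
     is defined. *)
  pose Z' : {RV Q >-> measurableTypeR R} := HB.pack (Z : T' -> measurableTypeR R)
    (isMeasurableFun.Build _ _ _ _ _ mZ).
  transitivity (\int[distribution Q Z']_z (f (sn * z))%:E)%E.
    by rewrite ge0_integral_distribution.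
  apply: eq_measure_integral => A mA _.
  exact: hZ.
rewrite eg.
apply: ge0_le_integral => //.
- by move=> t _; apply: integral_ge0 => w _; rewrite lee_fin pos5_ge0.
- by move=> t _; exact: (@pos5_supermartingale_le R d T P H S s n t hH hS hS0 hX).
Qed.
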